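(* Let $n\ge 5$, $F=\{5,\dots,n\}$, and let $G=\langle x_{1,\{f\}}: f\in F\rangle\le\mathrm{Out}^0(W_n)$ (so $G\cong\mathbb{Z}_2^{\,n-4}$), acting on $K_n$ by simplicial automorphisms. Then the fixed point set of $G$ in $K_n$ is exactly the union of the simplices spanned by the vertices $[\alpha,\widetilde\Theta]$ with $\alpha\in\mathrm{Out}^0(W_4)$ (embedded in $\mathrm{Out}^0(W_n)$ via $y_{i,D}\mapsto x_{i,D}$) and $\widetilde\Theta\in\widetilde{\mathcal{HT}_4}$; and this subcomplex is simplicially isomorphic to $K_4$, via $[\alpha,\Theta]\mapsto[\alpha,\widetilde\Theta]$, compatibly with the action of $\mathrm{Out}^0(W_4)$.
   Context: $W_n=\langle a_1,\dots,a_n\mid a_i^2=1\rangle$, $[n]=\{1,\dots,n\}$. For $i\in[n]$ and nonempty $D\subseteq[n]\setminus\{i\}$, the partial conjugation $x_{i,D}$ sends $a_j\mapsto a_ia_ja_i$ for $j\in D$ and fixes the others. $\mathrm{Out}^0(W_n)=\mathrm{Aut}^0(W_n)/\mathrm{Inn}(W_n)$ with $\mathrm{Aut}^0(W_n)$ the automorphisms sending each $a_j$ to a conjugate of itself. Partial conjugations of $W_4$ are denoted $y_{i,D}$; $y_{i,D}\mapsto x_{i,D}$ (with $D\subseteq[4]$) defines an injective homomorphism $\mathrm{Out}^0(W_4)\to\mathrm{Out}^0(W_n)$, whose image is denoted $\mathrm{Out}^0(W_4)$. A hypertree on $[n]$ is a set of subsets (hyperedges) of $[n]$ of size $\ge2$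 such that any two vertices are joined by a unique simple walk (alternating sequence of distinct vertices and distinct hyperedges, consecutive vertices in the intervening hyperedge); $\mathcal{HT}_n$ is the set of them. $\Theta\le\Lambda$ if $\Theta$ is obtained from $\Lambda$ by finitely many folds (replacing two intersecting distinct hyperedges by their union). $\Theta$ carries $x_{i,D}$ if for every $d\in D$, $j\in[n]\setminus(D\cup\{i\})$ the simple walk from $d$ to $j$ visits $i$; $\alpha$ is carried by $\Theta$ if it is a product of partial conjugations carried by $\Theta$. For $\Theta\in\mathcal{HT}_4$, $\widetilde\Theta\in\mathcal{HT}_n$ is the hypertree on $[n]$ whose hyperedges are those of $\Theta$ together with $\{1,f\}$ for each $f\in F$; $\widetilde{\mathcal{HT}_4}=\{\widetilde\Theta:\Theta\in\mathcal{HT}_4\}$. McCullough–Miller space $K_n$: on $\mathrm{Out}^0(W_n)\times\mathcal{HT}_n$ set $(\alpha,\Theta)\sim(\beta,\Lambda)$ iff $\Theta=\Lambda$ and $\alpha^{-1}\beta$ is carried by $\Theta$, classes $[\alpha,\Theta]$, ordered by $[\alpha,\Theta]\le[\beta,\Lambda]$ iff $\Theta\le\Lambda$ and $\alpha^{-1}\beta$ is carried by $\Lambda$; $K_n$ is the order complex of this poset. $\mathrm{Out}^0(W_n)$ acts by $\varphi\cdot[\alpha,\Theta]=[\varphi\alpha,\Theta]$.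
   Formalization: As y_{1,{2,3,4}} is inner but x_{1,{2,3,4}} is not, y_{i,D}↦x_{i,D} is ill-defined on Out⁰(W_4); instead α is extended by conjugating each a_f (f∈F) like a_1 (so 1∉D if i≠1), unique up to G. The remark G≅Z_2^{n-4} is not stated. *)

(* Defs.v *)
(* Generators a_1..a_n of W_n are indexed by 'I_n, with
   a_k represented by the ordinal of value k-1.  In particular the paper's
   vertex 1 is the ordinal of value 0, and F = {5..n} is {f : 'I_n | 4 <= f}. *)
From HB Require Import structures.
From mathcomp Require Import all_boot.
Set Implicit Arguments. Unset Strict Implicit. Unset Printing Implicit Defensive.

(* ---------- The group W_n = <a_1..a_n | a_i^2 = 1>, as reduced words ---------- *)

Definition push n (i : 'I_n) (w : seq 'I_n) : seq 'I_n :=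
  match w with
  | j :: w' => if i == j then w' else i :: w
  | [::] => [:: i]
  end.

Definition reduce n (w : seq 'I_n) : seq 'I_n := foldr (@push n) [::] w.

Definition conjw n (w : seq 'I_n) (i : 'I_n) : seq 'I_n := reduce (w ++ i :: rev w).

Definition endo n := 'I_n -> seq 'I_n.

Definition apply n (phi : endo n) (w : seq 'I_n) : seq 'I_n :=
  reduce (flatten (map phi w)).

Definition ecomp n (phi psi : endo n) : endo n := fun i => apply phi (psi i).
Definition idE n : endo n := fun i => [:: i].
Definition eqE n (phi psi : endo n) : Prop := forall i, phi i = psi i.

Definition conj_type n (phi : endo n) : Prop := forall i, exists w, phi i = conjw w i.

Definition is_aut0 n (phi : endo n) : Prop :=
  conj_type phi /\
  exists psi, conj_type psi /\ eqE (ecomp phi psi) (@idE n) /\ eqE (ecomp psi phi) (@idE n).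

Definition inner n (w : seq 'I_n) : endo n := fun i => conjw w i.

Definition eq_out n (phi psi : endo n) : Prop :=
  exists w, eqE psi (ecomp (inner w) phi).

Definition pconj n (i : 'I_n) (D : {set 'I_n}) : endo n :=
  fun j => if j \in D then [:: i; j; i] else [:: j].
Definition valid_pc n (i : 'I_n) (D : {set 'I_n}) : bool := (i \notin D) && (D != set0).

Definition prodpc n (l : seq ('I_n * {set 'I_n})) : endo n :=
  foldr (fun p acc => ecomp (pconj p.1 p.2) acc) (@idE n) l.

Definition hyp n := {set {set 'I_n}}.

Fixpoint walk_ok n (T : hyp n) (u : 'I_n) (vs : seq 'I_n) (es : seq {set 'I_n}) : Prop :=
  match vs, es with
  | [::], [::] => True
  | v :: vs', e :: es' => e \in T /\ u \in e /\ v \in e /\ walk_ok T v vs' es'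
  | _, _ => False
  end.

Definition swalk n (T : hyp n) (u v : 'I_n) (vs : seq 'I_n) (es : seq {set 'I_n}) : Prop :=
  walk_ok T u vs es /\ last u vs = v /\ uniq (u :: vs) /\ uniq es.

Definition is_hypertree n (T : hyp n) : Prop :=
  (forall E, E \in T -> 2 <= #|E|) /\
  forall u v : 'I_n,
    (exists vs es, swalk T u v vs es) /\
    (forall vs es vs' es', swalk T u v vs es -> swalk T u v vs' es' -> vs = vs' /\ es = es').

Definition fold1 n (L T : hyp n) : Prop :=
  exists E1 E2, [/\ E1 \in L, E2 \in L, E1 != E2, E1 :&: E2 != set0 &
                    T = (L :\ E1 :\ E2) :|: [set E1 :|: E2]].

Inductive folds_to n (L : hyp n) : hyp n -> Prop :=
  | ft_refl : folds_to L L
  | ft_step T T' : folds_to L T -> fold1 T T' -> folds_to L T'.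

Definition ht_le n (T L : hyp n) : Prop := folds_to L T.

Definition carries n (T : hyp n) (i : 'I_n) (D : {set 'I_n}) : Prop :=
  forall d j : 'I_n, d \in D -> j \notin D -> j != i ->
    forall vs es, swalk T d j vs es -> i \in d :: vs.

Definition carried_list n (T : hyp n) (l : seq ('I_n * {set 'I_n})) : Prop :=
  forall p, p \in l -> valid_pc p.1 p.2 /\ carries T p.1 p.2.

(* ---------- McCullough--Miller space K_n (vertices via representatives) ---------- *)
Definition vtx n := (endo n * hyp n)%type.

Definition valid_vtx n (v : vtx n) : Prop := is_aut0 v.1 /\ is_hypertree v.2.

Definition vrel n (v w : vtx n) : Prop :=
  v.2 = w.2 /\ exists l, carried_list v.2 l /\ eq_out w.1 (ecomp v.1 (prodpc l)).

Definition vle n (v w : vtx n) : Prop :=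
  ht_le v.2 w.2 /\ exists l, carried_list w.2 l /\ eq_out w.1 (ecomp v.1 (prodpc l)).

Definition act n (g : endo n) (v : vtx n) : vtx n := (ecomp g v.1, v.2).

Fixpoint inL A (x : A) (s : seq A) : Prop :=
  match s with [::] => False | y :: s' => x = y \/ inL x s' end.

(* a simplex of K_n: a finite chain of vertices *)
Definition is_chain n (s : seq (vtx n)) : Prop :=
  (forall v, inL v s -> valid_vtx v) /\
  (forall v w, inL v s -> inL w s -> vle v w \/ vle w v).

Definition inG n (g : endo n) : Prop :=
  exists l : seq ('I_n * {set 'I_n}),
    (forall p, p \in l -> val p.1 = 0 /\ exists f : 'I_n, 4 <= f /\ p.2 = [set f]) /\
    eq_out g (prodpc l).

Definition tilde n (T : hyp 4) : hyp n :=
  [set [set x : 'I_n | [exists y : 'I_4, (y \in E) && (val y == val x)]] | E : {set 'I_4} in T] :|: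
  [set [set x : 'I_n | (val x == 0) || (x == f)] | f in [set f : 'I_n | 4 <= f]].

(* beta : endo n represents the image of phi in Aut^0(W_n):
   it agrees with phi on a_1..a_4, and sends a_f (f in F) to u a_f u^{-1}
   where phi(a_1) = u a_1 u^{-1}  (the a_f are conjugated "like a_1").
   The choice of u (u or u a_1) only matters up to G. *)
Definition ext_rel n (phi : endo 4) (beta : endo n) : Prop :=
  (forall (j : 'I_4) (j' : 'I_n), val j = val j' -> map val (beta j') = map val (phi j)) /\
  (forall f : 'I_n, 4 <= f ->
     exists (o : 'I_4) (u : seq 'I_4) (u' : seq 'I_n),
       [/\ val o = 0, phi o = conjw u o, map val u' = map val u & beta f = conjw u' f]).

Definition in_tilde_span n (v : vtx n) : Prop :=
  exists (phi : endo 4) (T : hyp 4) (beta : endo n),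
    [/\ is_aut0 phi, is_hypertree T, ext_rel phi beta & vrel v (beta, tilde n T)].

(* Main.v *)
(* The group [G] fixes the vertex [[alpha, Theta]] iff each product
   [alpha^-1 x_{1,f} alpha] is, up to an inner automorphism, a product of partial
   conjugations carried by [Theta].  Normalise [alpha] to fix [a_1] and these
   partial conjugations to have [1] outside [D]: connectedness of [Theta] then makes
   them commute, so their product is determined by its parity matrix (the number of
   letters [a_k] in a conjugator of [a_j], modulo 2).  This matrix is additive, hence
   a conjugation invariant, and the product must be [x_{1,f}] itself.  Therefore
   [Theta] carries [x_{1,f}], i.e. [f] is a leaf attached to [1] and
   [Theta = tilde T], and [alpha] commutes with [x_{1,f}].  The latter forces
   [alpha] to preserve [<a_1, .., a_4>], the fixed subgroup of all the [x_{1,f}],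
   and each infinite dihedral group [<a_1, a_f>], whose automorphisms are the
   obvious ones; so [alpha] extends an element of [Aut^0(W_4)].

   The embedding is inverted, on representatives, by the retraction of [W_n] onto
   [W_4] killing the [a_f]; two extensions of the same automorphism differ by an
   element of [G], which is carried by every [tilde T]. *)
Require Import Defs.
From HB Require Import structures.
From mathcomp Require Import all_boot.
From Stdlib Require Import Setoid FunctionalExtensionality.
Set Implicit Arguments. Unset Strict Implicit. Unset Printing Implicit Defensive.

Arguments reduce : simpl never.
Arguments conjw : simpl never.
Arguments apply : simpl never.

(** * Reduced words *)

Section Words.
Variable n : nat.
Implicit Types (i j k : 'I_n) (u v w z : seq 'I_n).

Definition reduced w := sorted [rel x y : 'I_n | x != y] w.

Lemma reduced_cons i w : reduced (i :: w) = (ohead w != Some i) && reduced w.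
Proof. by case: w => //= j w; rewrite eq_sym. Qed.

Lemma push_reduced i w : reduced w -> reduced (push i w).
Proof.
case: w => //= j w; case: eqP => [_|/eqP ij] rw; last by rewrite /= ij.
exact: path_sorted rw.
Qed.

Lemma pushE i w : ohead w != Some i -> push i w = i :: w.
Proof. by case: w => //= j w; rewrite (inj_eq Some_inj) eq_sym; case: eqP. Qed.

Lemma pushK i w : reduced w -> push i (push i w) = w.
Proof.
case: w => [|j w] /=; first by rewrite eqxx.
case: eqP => [->|_] rw /=; last by rewrite eqxx.
by rewrite pushE //; have: reduced (j :: w) by []; rewrite reduced_cons => /andP[].
Qed.

Lemma foldr_push_reduced u w : reduced w -> reduced (foldr (@push n) w u).
Proof. by move=> rw; elim: u => //= i u; apply: push_reduced. Qed.

Lemma reduce_reduced w : reduced (reduce w).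
Proof. exact: foldr_push_reduced. Qed.

Lemma reduce_id w : reduced w -> reduce w = w.
Proof.
elim: w => // i w IH; rewrite reduced_cons => /andP[hd rw].
by rewrite /reduce /= -/(reduce w) IH // pushE.
Qed.

Lemma reduceK w : reduce (reduce w) = reduce w.
Proof. exact/reduce_id/reduce_reduced. Qed.

Lemma reduce_cons i w : reduce (i :: w) = push i (reduce w).
Proof. by []. Qed.

Lemma reduce_cat u v : reduce (u ++ v) = foldr (@push n) (reduce v) u.
Proof. exact: foldr_cat. Qed.

Lemma reduce_catr u v : reduce (u ++ reduce v) = reduce (u ++ v).
Proof. by rewrite !reduce_cat reduceK. Qed.

(** Makes [reduce] compatible with concatenation, so that [reduce (u ++ v)] is the product in W_n.
    The only real case is a cancellation at the head of [reduce u], settled by [pushK]. *)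
Lemma reduce_catl u v : reduce (reduce u ++ v) = reduce (u ++ v).
Proof.
elim: u => //= i u IH; rewrite [RHS]reduce_cons -IH.
have := reduce_reduced u; rewrite [reduce (i :: u)]reduce_cons.
case: (reduce u) => [|j t] //= rt; case: eqP => [<-|//].
by rewrite reduce_cons pushK // reduce_reduced.
Qed.

Lemma reduce_mid u v w : reduce (u ++ reduce v ++ w) = reduce (u ++ v ++ w).
Proof. by rewrite -reduce_catr reduce_catl reduce_catr. Qed.

Lemma reduce_ii i w : reduce (i :: i :: w) = reduce w.
Proof. by rewrite !reduce_cons pushK // reduce_reduced. Qed.

Lemma reduce_iim u i w : reduce (u ++ i :: i :: w) = reduce (u ++ w).
Proof. by rewrite -reduce_catr reduce_ii reduce_catr. Qed.

Lemma reduce_cat_rev u v : reduce (u ++ rev u ++ v) = reduce v.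
Proof.
elim: u v => //= i u IH v; rewrite rev_cons -cats1 -catA reduce_cons IH /=.
by rewrite reduce_cons pushK // reduce_reduced.
Qed.

Lemma reduce_rev_cat u v : reduce (rev u ++ u ++ v) = reduce v.
Proof. by have := reduce_cat_rev (rev u) v; rewrite revK. Qed.

Lemma reduced_rev w : reduced (rev w) = reduced w.
Proof.
rewrite /reduced rev_sorted; apply: eq_sorted => x y.
by rewrite /= eq_sym.
Qed.

(** Both sides are reduced inverses of [w]: prefix the right one by [rev w ++ w] and cancel the
    other way. *)
Lemma reduce_rev w : reduce (rev w) = rev (reduce w).
Proof.
have h : reduced (rev (reduce w)) by rewrite reduced_rev reduce_reduced.
rewrite -[RHS](reduce_id h) -[RHS](reduce_rev_cat w) -[RHS](reduce_mid (rev w)).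
by rewrite -[in RHS]reduce_catr -[rev (reduce w)]cats0 reduce_cat_rev cats0.
Qed.

Lemma mem_reduce w : {subset reduce w <= w}.
Proof.
elim: w => //= i w IH x; rewrite reduce_cons inE.
have : {subset push i (reduce w) <= i :: reduce w}.
  case: (reduce w) => //= j t y; case: eqP => // _ yt.
  by rewrite !inE yt !orbT.
by move=> sub /sub; rewrite inE => /orP[->//|/IH ->]; rewrite orbT.
Qed.

Lemma odd_count_reduce k w : odd (count_mem k (reduce w)) = odd (count_mem k w).
Proof.
elim: w => //= i w IH; rewrite reduce_cons oddD -IH.
case: (reduce w) => [|j t] //=; first by rewrite oddD.
case: eqP => [->|_]; last by rewrite /= !oddD.
by rewrite oddD addbA addbb.
Qed.

Lemma conjw_reduce w i : conjw (reduce w) i = conjw w i.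
Proof.
by rewrite /conjw -reduce_rev -cat1s reduce_catl catA reduce_catr -catA.
Qed.

Lemma conjw_cat u v i : conjw (u ++ v) i = reduce (u ++ conjw v i ++ rev u).
Proof. by rewrite /conjw reduce_mid rev_cat -!catA /=. Qed.

Lemma conjw_rcons w i : conjw (rcons w i) i = conjw w i.
Proof.
by rewrite -cats1 conjw_cat [conjw [:: i] i]reduce_ii.
Qed.

Lemma rev_conjw w i : rev (conjw w i) = conjw w i.
Proof. by rewrite -reduce_rev rev_cat rev_cons revK cat_rcons. Qed.

Lemma conjw_reduced w i : reduced (conjw w i).
Proof. exact: reduce_reduced. Qed.

Lemma conjw_invol w i : reduce (conjw w i ++ conjw w i) = [::].
Proof. by rewrite -{2}rev_conjw -[rev _]cats0 reduce_cat_rev. Qed.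

Lemma odd_count_conjw k w i : odd (count_mem k (conjw w i)) = (i == k).
Proof.
rewrite odd_count_reduce count_cat /= count_rev addnCA oddD addnn odd_double addbF.
by case: (i == k).
Qed.

Lemma reduced_conjw w i : reduced w -> ohead (rev w) != Some i ->
  conjw w i = w ++ i :: rev w.
Proof.
case: w => [|x w] // rw hd; apply: reduce_id.
have : reduced (i :: rev (x :: w)) by rewrite reduced_cons hd reduced_rev.
move: hd; rewrite {1}[x :: w]lastI rev_rcons (inj_eq Some_inj) => hd ri.
by rewrite /reduced /= cat_path; apply/and3P; split.
Qed.

(** The centraliser of a_i is {1, a_i}: once a final [i] is stripped from a reduced [w], the word
    [w ++ i :: rev w] is already reduced, of length 2|w|+1. *)
Lemma conjw_eq1 w i : conjw w i = [:: i] -> reduce w = [::] \/ reduce w = [:: i].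
Proof.
rewrite -conjw_reduce; have := reduce_reduced w; move: (reduce w) => {w}.
have base w : reduced w -> ohead (rev w) != Some i -> conjw w i = [:: i] -> w = [::].
  move=> rw hd; rewrite reduced_conjw // => /(congr1 size).
  by rewrite size_cat /= addnS => -[]; case: w {rw hd}.
case/lastP => [|w x]; first by left.
rewrite -reduced_rev rev_rcons reduced_cons => /andP[hd rw] cj.
have [xi|xi] := eqVneq x i.
  right; rewrite xi conjw_rcons in cj; rewrite xi in hd; rewrite (base w) ?xi //.
  by rewrite -reduced_rev.
left; apply: base => //; last by rewrite rev_rcons (inj_eq Some_inj).
by rewrite -reduced_rev rev_rcons reduced_cons hd.
Qed.

Lemma conjw_inj u v i : conjw u i = conjw v i ->
  reduce (rev v ++ u) = [::] \/ reduce (rev v ++ u) = [:: i].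
Proof.
move=> e; apply: conjw_eq1; rewrite conjw_cat e revK /conjw reduce_mid.
by rewrite -catA reduce_rev_cat /= -[rev v ++ v]cats0 -catA -cat1s -reduce_catr reduce_rev_cat.
Qed.

(** A conjugator of a_i is unique up to right multiplication by a_i, which does not affect the
    parity of any other letter. This makes [parity] well defined off the diagonal. *)
Lemma conjw_odd_inj u v i k : k != i -> conjw u i = conjw v i ->
  odd (count_mem k u) = odd (count_mem k v).
Proof.
move=> ki /conjw_inj h; have : odd (count_mem k (rev v ++ u)) = false.
  rewrite -odd_count_reduce; case: h => ->//=.
  by rewrite eq_sym (negPf ki).
by rewrite count_cat count_rev oddD; case: odd; case: odd.
Qed.

End Words.

(** * Endomorphisms and parity *)

Section Endos.
Variable n : nat.
Implicit Types (i j k : 'I_n) (u v w z : seq 'I_n) (f g h phi psi : endo n) (D E : {set 'I_n})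
  (p : 'I_n * {set 'I_n}) (l : seq ('I_n * {set 'I_n})).

Lemma eqE_eq phi psi : Defs.eqE phi psi -> phi = psi.
Proof. exact: functional_extensionality. Qed.

Lemma apply_cat phi u v : apply phi (u ++ v) = reduce (apply phi u ++ apply phi v).
Proof. by rewrite /apply map_cat flatten_cat reduce_catl reduce_catr. Qed.

Lemma apply_cons phi i w : apply phi (i :: w) = reduce (phi i ++ apply phi w).
Proof. by rewrite /apply /= reduce_catr. Qed.

Lemma apply_seq1 phi i : apply phi [:: i] = reduce (phi i).
Proof. by rewrite /apply /= cats0. Qed.

Lemma apply_reduced phi w : reduced (apply phi w).
Proof. exact: reduce_reduced. Qed.

Lemma conj_type_reduced phi i : conj_type phi -> reduced (phi i).
Proof. by move=> /(_ i)[w ->]; apply: conjw_reduced. Qed.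

(** Each generator goes to an involution, so cancelling pairs are respected and [phi] acts on the
    group, not just on words. *)
Lemma apply_reduce phi w : conj_type phi -> apply phi (reduce w) = apply phi w.
Proof.
move=> cphi; elim: w => // i w IH; rewrite [RHS]apply_cons -IH reduce_cons.
case: (reduce w) => [|j t] /=; first by rewrite apply_cons.
case: eqP => [->|_]; last by rewrite apply_cons.
rewrite apply_cons reduce_catr catA -reduce_catl.
by have [u ->] := cphi j; rewrite conjw_invol reduce_id // apply_reduced.
Qed.

Lemma apply_rev phi w : conj_type phi -> apply phi (rev w) = rev (apply phi w).
Proof.
move=> cphi; elim: w => // i w IH.
rewrite rev_cons -cats1 apply_cat IH apply_seq1 apply_cons -[RHS]reduce_rev rev_cat.
by rewrite reduce_catr; have [u ->] := cphi i; rewrite rev_conjw.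
Qed.

Lemma apply_conjw phi u w i : conj_type phi -> phi i = conjw u i ->
  apply phi (conjw w i) = conjw (apply phi w ++ u) i.
Proof.
move=> cphi e; rewrite {1}/conjw apply_reduce // apply_cat apply_cons.
by rewrite apply_rev // reduce_catr e conjw_cat.
Qed.

Lemma apply_ecomp f g w : conj_type f -> apply (ecomp f g) w = apply f (apply g w).
Proof.
move=> cf; rewrite [apply g w]/apply apply_reduce //.
elim: w => // i w IH; rewrite apply_cons IH /= apply_cat.
by rewrite reduce_catl.
Qed.

Lemma ecompA f g h : conj_type f -> ecomp f (ecomp g h) = ecomp (ecomp f g) h.
Proof. by move=> cf; apply: eqE_eq => i; rewrite [RHS]apply_ecomp. Qed.

Lemma ecompi1 phi : conj_type phi -> ecomp phi (@idE n) = phi.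
Proof.
by move=> c; apply: eqE_eq => i; rewrite /ecomp apply_seq1 reduce_id // conj_type_reduced.
Qed.

Lemma apply_id w : apply (@idE n) w = reduce w.
Proof. by rewrite /apply; congr reduce; elim: w => //= i w ->. Qed.

Lemma ecomp1i phi : conj_type phi -> ecomp (@idE n) phi = phi.
Proof.
by move=> c; apply: eqE_eq => i; rewrite /ecomp apply_id reduce_id // conj_type_reduced.
Qed.

Lemma conj_type_id : conj_type (@idE n).
Proof. by move=> i; exists [::]. Qed.

Lemma conj_type_inner w : conj_type (inner w).
Proof. by move=> i; exists w. Qed.

Lemma conj_type_ecomp f g : conj_type f -> conj_type g -> conj_type (ecomp f g).
Proof.
move=> cf cg i; have [w e] := cg i; have [u e'] := cf i.
by exists (apply f w ++ u); rewrite /ecomp e (apply_conjw _ _ e').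
Qed.

Lemma apply_inner u w : apply (inner u) w = reduce (u ++ w ++ rev u).
Proof.
elim: w => [|i w IH]; first by rewrite /apply /= -[rev u]cats0 reduce_cat_rev.
rewrite apply_cons IH reduce_catr /inner /conjw reduce_catl -catA /=.
rewrite -cat_rcons -[in RHS]cat1s -(cat_rcons i u).
by rewrite -[LHS]reduce_catr reduce_rev_cat reduce_catr !cat_rcons.
Qed.

Lemma innerM u v : ecomp (inner u) (inner v) = inner (u ++ v).
Proof. by apply: eqE_eq => i; rewrite /ecomp apply_inner /inner conjw_cat. Qed.

Lemma inner_reduce u : inner (reduce u) = inner u.
Proof. by apply: eqE_eq => i; rewrite /inner conjw_reduce. Qed.

Lemma inner_nil : inner [::] = @idE n.
Proof. by []. Qed.

Lemma innerVK u : ecomp (inner (rev u)) (inner u) = @idE n.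
Proof. by rewrite innerM -inner_reduce -[_ ++ _]cats0 -catA reduce_rev_cat. Qed.

Lemma innerKV u : ecomp (inner u) (inner (rev u)) = @idE n.
Proof. by rewrite innerM -inner_reduce -[_ ++ _]cats0 -catA reduce_cat_rev. Qed.

Lemma ecomp_inner f w : conj_type f -> ecomp f (inner w) = ecomp (inner (apply f w)) f.
Proof.
move=> cf; apply: eqE_eq => i; have [u e] := cf i.
by rewrite /ecomp (apply_conjw _ _ e) // e apply_inner conjw_cat.
Qed.

Lemma inner_cancel w f g : conj_type f -> conj_type g ->
  ecomp (inner w) f = g -> f = ecomp (inner (rev w)) g.
Proof.
move=> cf cg <-; rewrite ecompA ?innerVK ?ecomp1i //; exact: conj_type_inner.
Qed.

Lemma conj_type_pconj i D : i \notin D -> conj_type (pconj i D).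
Proof.
move=> iD j; rewrite /pconj; case: ifP => [jD|_]; last by exists [::].
have ij : i != j by apply: contraNneq iD => ->.
exists [:: i]; rewrite [conjw _ _]reduce_id //.
by rewrite /reduced /= ij eq_sym ij.
Qed.

Lemma pconj0 i : pconj i set0 = @idE n.
Proof. by apply: eqE_eq => j; rewrite /pconj inE. Qed.

Definition symdiff (D E : {set 'I_n}) : {set 'I_n} := [set x | (x \in D) (+) (x \in E)].

Lemma pconjM i D E : i \notin D -> i \notin E ->
  ecomp (pconj i D) (pconj i E) = pconj i (symdiff D E).
Proof.
move=> iD iE; apply: eqE_eq => j.
rewrite /ecomp {2 3}/pconj inE; case: (boolP (j \in E)) => jE.
  rewrite /apply /= /pconj (negPf iD); case: (boolP (j \in D)) => jD /=.
    by rewrite reduce_ii -[[:: j; i; i]]/([:: j] ++ [:: i; i]) -reduce_catr reduce_ii.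
  by have := conj_type_reduced j (conj_type_pconj iE); rewrite /pconj jE => /reduce_id.
rewrite apply_seq1 addbF; apply: reduce_id.
exact: conj_type_reduced (conj_type_pconj iD).
Qed.

Lemma pconjK i D : i \notin D -> ecomp (pconj i D) (pconj i D) = @idE n.
Proof.
move=> iD; rewrite pconjM // (_ : symdiff _ _ = set0) ?pconj0 //.
by apply/setP=> x; rewrite !inE addbb.
Qed.

Lemma inner_pconj i : inner [:: i] = pconj i (~: [set i]).
Proof.
apply: eqE_eq => j; rewrite /inner /pconj !inE.
case: eqVneq => [->|ji]; first by rewrite [conjw _ _]reduce_ii.
by rewrite [conjw _ _]reduce_id // /reduced /= ji eq_sym ji.
Qed.

(** D and its complement in the vertices other than i give the same outer class, which allows a
    chosen vertex to be kept out of D. *)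
Lemma pconj_setC i D : i \notin D ->
  pconj i D = ecomp (inner [:: i]) (pconj i (~: [set i] :\: D)).
Proof.
move=> iD; rewrite inner_pconj pconjM ?inE ?eqxx ?andbF //.
congr pconj; apply/setP => x; rewrite !inE.
by case: eqVneq => [->|_]; rewrite ?(negPf iD) //; case: (x \in D).
Qed.

Definition wf_list l := all (fun p : 'I_n * {set 'I_n} => p.1 \notin p.2) l.

Lemma conj_type_prodpc l : wf_list l -> conj_type (prodpc l).
Proof.
elim: l => [|p l IH] /=; first by move=> _; apply: conj_type_id.
by case/andP=> pp /IH c; apply: conj_type_ecomp => //; apply: conj_type_pconj.
Qed.

Lemma prodpc_cat l l' : wf_list l -> wf_list l' ->
  prodpc (l ++ l') = ecomp (prodpc l) (prodpc l').
Proof.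
move=> + wl'; elim: l => [|p l IH] /=; first by rewrite ecomp1i //; apply: conj_type_prodpc.
by case/andP=> pp wl; rewrite IH // ecompA //; apply: conj_type_pconj.
Qed.

Lemma prodpc1 p : p.1 \notin p.2 -> prodpc [:: p] = pconj p.1 p.2.
Proof. by move=> pp; rewrite /= ecompi1 //; apply: conj_type_pconj. Qed.

Lemma prodpcVK l : wf_list l -> ecomp (prodpc l) (prodpc (rev l)) = @idE n.
Proof.
elim: l => [|p l IH] /=; first by rewrite ecomp1i //; apply: conj_type_id.
case/andP=> pp wl; have wr : wf_list (rev l) by rewrite /wf_list all_rev.
have cp := conj_type_pconj pp; have cl := conj_type_prodpc wl.
rewrite rev_cons -cats1 prodpc_cat //=; last by rewrite pp.
rewrite ecompi1 // -ecompA // (ecompA _ _ cl) IH // ecomp1i // pconjK //.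
Qed.

(** Entry (k, j) of the parity matrix, stated as a relation because conjugators are not unique. It
    pins down [b] only when k differs from j, since a conjugator of a_j may absorb a further a_j. *)
Definition parity phi k j b := exists w, phi j = conjw w j /\ odd (count_mem k w) = b.

Lemma parity_inj phi k j b b' : k != j -> parity phi k j b -> parity phi k j b' -> b = b'.
Proof. by move=> kj [w [e <-]] [w' [e' <-]]; apply: conjw_odd_inj kj _; rewrite -e -e'. Qed.

Lemma odd_count_apply phi k w : conj_type phi ->
  odd (count_mem k (apply phi w)) = odd (count_mem k w).
Proof.
move=> cphi; elim: w => // i w IH.
rewrite apply_cons odd_count_reduce count_cat oddD IH /= oddD; congr addb.
by have [u ->] := cphi i; rewrite odd_count_conjw; case: (i == k).
Qed.

(** The composite has conjugator [apply f w ++ u], and [apply f] preserves the parity of every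
    letter; hence matrices add. *)
Lemma parity_ecomp f g k j b c : conj_type f -> parity f k j b -> parity g k j c ->
  parity (ecomp f g) k j (b (+) c).
Proof.
move=> cf [u [eu <-]] [w [ew <-]]; exists (apply f w ++ u).
by rewrite /ecomp ew (apply_conjw _ cf eu) count_cat oddD odd_count_apply // addbC.
Qed.

Lemma parity_pconj i D k j : i \notin D -> parity (pconj i D) k j ((i == k) && (j \in D)).
Proof.
move=> iD; rewrite /parity /pconj; case: ifP => jD; last by exists [::]; rewrite andbF.
exists [:: i]; rewrite /= addn0 oddb andbT; split=> //.
have ij : i != j by apply: contraNneq iD => ->.
by rewrite [conjw _ _]reduce_id // /reduced /= ij eq_sym ij.
Qed.

(** Row k of the parity matrix of [prodpc l], as the symmetric difference of all sets paired with k
    in [l]. *)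
Definition supp k l : {set 'I_n} :=
  [set j | odd (count (fun p : 'I_n * {set 'I_n} => (p.1 == k) && (j \in p.2)) l)].

Lemma parity_prodpc l k j : wf_list l -> parity (prodpc l) k j (j \in supp k l).
Proof.
rewrite inE; elim: l => [|p l IH] /=; first by exists [::].
case/andP=> pp /IH c; rewrite oddD oddb; apply: parity_ecomp => //.
  exact: conj_type_pconj.
exact: parity_pconj.
Qed.

End Endos.

(** * Fixed words of a partial conjugation *)

Section Fixed.
Variable n : nat.
Implicit Types (i j k d : 'I_n) (u v w x y z : seq 'I_n) (D : {set 'I_n}).

Lemma push_ohead i w : ohead w != Some i -> ohead (push i w) = Some i.
Proof. by move=> h; rewrite pushE. Qed.

(** Cancellation in the image only happens between letters [i], so the first letter of the word
    predicts the head of its image. An initial [i] predicts nothing, which is why the induction is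
    on size and may look two letters ahead. *)
Lemma head_apply_pconj i D k w : i \notin D -> reduced (k :: w) ->
  (k \in D -> exists z, apply (pconj i D) (k :: w) = [:: i, k & z]) /\
  (k \notin D -> k != i -> exists z, apply (pconj i D) (k :: w) = k :: z).
Proof.
move=> iD; have [m] := ubnP (size w); elim: m k w => // m IH k w /ltnSE le_w rw.
have app j s : apply (pconj i D) (j :: s) =
    if j \in D then push i (push j (push i (apply (pconj i D) s)))
    else push j (apply (pconj i D) s).
  rewrite apply_cons reduce_cat reduce_id ?apply_reduced // /pconj.
  by case: ifP.
have tail j s : k :: w = [:: k, j & s] ->
    [/\ size s < m, reduced (j :: s) & j != k].
  move=> [ew]; move: le_w rw; rewrite ew /= => le_s /andP[kj rs].
  by split=> //; rewrite eq_sym.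
split=> [kD|kD ki]; rewrite app ?(negPf kD) ?kD.
- have ki : k != i by apply: contraNneq iD => <-.
  suff h : ohead (push i (apply (pconj i D) w)) != Some k.
    rewrite (pushE h) pushE ?(inj_eq Some_inj) //=; by eexists.
  case: w le_w rw tail app => [|j s] le_w rw tail app.
    by rewrite /apply /= (inj_eq Some_inj) eq_sym.
  have [s_m rj jk] := tail _ _ erefl.
  have [jD|jD] := boolP (j \in D).
    have [[//|z ->] _] := IH _ _ s_m rj.
    by rewrite /= eqxx /= (inj_eq Some_inj).
  have [ji|ji] := eqVneq j i; last first.
    have [_ [//|//|z ->]] := IH _ _ s_m rj.
    by rewrite push_ohead /= (inj_eq Some_inj) // eq_sym.
  (* This [i] cancels the one produced by [k], so the next letter [e], distinct from [i], decides:
     the image starts with [i] or [e], and neither is [k]. *)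
  rewrite app (negPf jD) ji pushK ?apply_reduced //.
  case: s {tail app le_w} rw s_m rj => [|e s] rw s_m rj //.
  have re : reduced (e :: s) by case/andP: rj.
  have ei : e != i by move: rj; rewrite ji /= eq_sym => /andP[].
  have es : size s < m by exact: ltnW s_m.
  have [eD|eD] := boolP (e \in D).
    have [[//|z ->] _] := IH _ _ es re.
    by rewrite /= (inj_eq Some_inj) eq_sym.
  have [_ [//|//|z ->]] := IH _ _ es re.
  by rewrite /= (inj_eq Some_inj); apply: contraNneq eD => ->.
- suff h : ohead (apply (pconj i D) w) != Some k by rewrite pushE //; eexists.
  case: w le_w rw tail app => [|j s] le_w rw tail app //.
  have [s_m rj jk] := tail _ _ erefl.
  have [jD|jD] := boolP (j \in D).
    have [[//|z ->] _] := IH _ _ s_m rj.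
    by rewrite /= (inj_eq Some_inj) eq_sym.
  have [ji|ji] := eqVneq j i; last first.
    have [_ [//|//|z ->]] := IH _ _ s_m rj.
    by rewrite /= (inj_eq Some_inj).
  rewrite app (negPf jD) ji.
  case: s {tail app le_w} rw s_m rj => [|e s] rw s_m rj //.
    by rewrite /apply /= (inj_eq Some_inj) eq_sym.
  have re : reduced (e :: s) by case/andP: rj.
  have ei : e != i by move: rj; rewrite ji /= eq_sym => /andP[].
  have es : size s < m by exact: ltnW s_m.
  have [eD|eD] := boolP (e \in D).
    have [[//|z ->] _] := IH _ _ es re.
    by rewrite /= eqxx /= (inj_eq Some_inj); apply: contraNneq kD => <-.
  have [_ [//|//|z ->]] := IH _ _ es re.
  by rewrite push_ohead /= (inj_eq Some_inj) // eq_sym.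
Qed.

(** A first letter in D would make the image begin with [i], which is outside D; any other first
    letter is fixed and can be stripped from both sides. *)
Lemma pconj_fixed i D w : i \notin D -> reduced w -> apply (pconj i D) w = w ->
  {in w, forall k, k \notin D}.
Proof.
move=> iD; elim: w => // k w IH rw e.
have kD : k \notin D.
  apply/negP => kD; have [[//|z] e' _] := head_apply_pconj iD rw.
  by move: e'; rewrite e => -[ki _]; move: iD; rewrite -ki kD.
have rw' : reduced w by move: rw; rewrite reduced_cons => /andP[].
suff e1 : apply (pconj i D) w = w.
  by move=> j; rewrite inE => /orP[/eqP->|/(IH rw' e1)].
have := congr1 (push k) e; rewrite apply_cons /pconj (negPf kD) reduce_cons.
rewrite (reduce_id (apply_reduced _ _)) pushK ?apply_reduced // => ->.
by rewrite /= eqxx.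
Qed.

(* If [x] starts and ends with [f], substituting it for [f] causes no
   cancellation, so [f] itself is only reached when [x = f]. *)
Lemma dihedral_size o f (phi : endo n) x y : phi o = [:: o] -> phi f = x ->
  o != f -> reduced x -> rev x = x -> ohead x = Some f ->
  {in y, forall k, k = o \/ k = f} -> reduced y -> apply phi y = [:: f] -> x = [:: f].
Proof.
move=> po pf of_ rx palx hx yof ry ey.
have red : reduced (flatten (map phi y)) /\ ohead (flatten (map phi y)) = ohead y.
  elim: y yof ry {ey} => //= k y IH yof ry.
  have yof' : {in y, forall k, k = o \/ k = f}.
    by move=> j jy; apply: yof; rewrite inE jy orbT.
  have [hy ry'] : ohead y != Some k /\ reduced y.
    by apply/andP; rewrite -reduced_cons.
  have [IHr IHh] := IH yof' ry'.
  case: (yof k (mem_head _ _)) => ek; rewrite ek in hy *.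
    by rewrite po -[[:: o] ++ _]/(o :: _) reduced_cons IHh hy IHr.
  rewrite pf.
  case: x rx palx hx {pf} => [|a x] // rx palx [ea]; rewrite ea in rx palx *.
  split=> //; rewrite /reduced /= cat_path; apply/andP; split=> //.
  have -> : last f x = f.
    by have := congr1 ohead palx; rewrite {1}lastI rev_rcons => -[].
  have : reduced (f :: flatten [seq phi i | i <- y]) by rewrite reduced_cons IHh hy.
  by [].
(* Without [f] in [y], the image would only involve [o]. Hence a whole copy of [x] sits inside the
   one-letter word [[:: f]]. *)
have fy : f \in y.
  apply/negPn/negP => fy; have h : y = nseq (size y) o.
    by apply/all_pred1P/allP => k ky /=; case: (yof k ky) => ek; [apply/eqP | rewrite -ek ky in fy].
  have : f \in apply phi y by rewrite ey mem_head.
  move/mem_reduce; rewrite h => /flattenP[s /mapP[k]].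
  by rewrite mem_nseq => /andP[_ /eqP ->] ->; rewrite po inE eq_sym (negPf of_).
move: ey; rewrite /apply reduce_id ?(proj1 red) // => ey.
have sx : size x <= 1.
  have -> : 1 = size (flatten (map phi y)) by rewrite ey.
  rewrite size_flatten sumnE /shape -map_comp big_map (big_rem f) //= pf.
  exact: leq_addr.
by case: x sx hx {palx pf rx} => [|a [|b x]] // _ [->].
Qed.

(** [phi f] is a palindrome in [o] and [f]. If it begins with [f], [dihedral_size] applies; if with
    [o], precomposing with x_{o,{f}} strips [o] from both ends and reduces to the first case, with
    [apply sg y] as preimage. *)
Lemma dihedral_aut o f (phi : endo n) y : conj_type phi -> phi o = [:: o] -> o != f ->
  {in phi f, forall k, k = o \/ k = f} ->
  {in y, forall k, k = o \/ k = f} -> reduced y -> apply phi y = [:: f] ->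
  phi f = [:: f] \/ phi f = [:: o; f; o].
Proof.
move=> cphi po of_ xof yof ry ey.
have [u eu] := cphi f.
have rx : reduced (phi f) by rewrite eu conjw_reduced.
have px : rev (phi f) = phi f by rewrite eu rev_conjw.
case ex: (phi f) => [|a x] in rx px xof *.
  have := odd_count_conjw f u f; by rewrite -eu ex eqxx.
case: (xof a (mem_head _ _)) => ea; last first.
  by left; apply: (@dihedral_size o f phi (a :: x) y) => //; rewrite ea.
right; rewrite {a}ea in rx px xof ex *.
case/lastP: x => [|x b] in rx px xof ex *.
  by have := odd_count_conjw f u f; rewrite -eu ex eqxx /= (negPf of_).
move: px; rewrite rev_cons rev_rcons => -[eb px]; rewrite {b}eb in rx px xof ex *.
have {}px : rev x = x by have [] := rcons_inj px.
pose sg := pconj o [set f]; have osg : o \notin [set f] by rewrite inE.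
have csg : conj_type sg := conj_type_pconj osg.
have h1 : reduced (rcons x o) by move: rx; rewrite reduced_cons => /andP[].
have rx' : reduced x.
  rewrite -px reduced_rev; move: h1.
  by rewrite -reduced_rev rev_rcons reduced_cons => /andP[]; rewrite reduced_rev.
have hx : ohead x = Some f.
  case: x rx xof {h1 rx' px ex} => [|a x] /=; first by rewrite eqxx.
  case/andP=> oa _ xof; case: (xof a) => [|ea|->//]; first by rewrite !inE eqxx orbT.
  by rewrite ea eqxx in oa.
suff -> : x = [:: f] by [].
apply: (@dihedral_size o f (ecomp phi sg) x (apply sg y)) => //.
- by rewrite /ecomp /sg /pconj (negPf osg) apply_seq1 po.
- rewrite /ecomp /sg /pconj set11 apply_cons po apply_cons ex apply_seq1 po.
  rewrite reduce_catr -cats1 /= -!cat_cons -catA reduce_ii /=.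
  by rewrite -[reduce _]reduce_catr reduce_ii cats0 reduce_id.
- move=> k /mem_reduce/flattenP[s /mapP[j jy ->]].
  rewrite /sg /pconj inE; case: ifP => [/eqP->|_]; rewrite !inE.
    by case/or3P=> /eqP->; [left|right|left].
  by move/eqP->; apply: yof.
- exact: apply_reduced.
by rewrite apply_ecomp // -(apply_ecomp _ _ csg) pconjK // apply_id reduce_id.
Qed.

End Fixed.

(** * Carried partial conjugations *)

Section Carried.
Variables (n : nat).
Implicit Types (T : hyp n) (i j k : 'I_n) (D E : {set 'I_n}).
Implicit Types (p : 'I_n * {set 'I_n}) (l : seq ('I_n * {set 'I_n})).

(* [D] is a union of components of the hypergraph [T] with the vertex [i] removed. *)
Definition splits T i D := forall (e : {set 'I_n}) x y,
  e \in T -> x \in e -> y \in e -> x != i -> y != i -> (x \in D) = (y \in D).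

Definition adj T : rel 'I_n := [rel x y | [exists e in T, (x \in e) && (y \in e)]].

Lemma walk_path T u vs es : walk_ok T u vs es -> path (adj T) u vs.
Proof.
elim: vs u es => // v vs IH u [|e es] //= [eT [ue [ve /IH ->]]].
by rewrite andbT; apply/existsP; exists e; rewrite eT ue ve.
Qed.

Lemma splits_path T i D u vs : splits T i D -> path (adj T) u vs -> i \notin u :: vs ->
  (u \in D) = (last u vs \in D).
Proof.
move=> sp; elim: vs u => //= v vs IH u /andP[/existsP[e /and3P[eT ue ve]] pv].
rewrite inE negb_or => /andP[iu iv]; rewrite -IH //.
apply: sp eT ue ve _ _; first by rewrite eq_sym.
by move: iv; rewrite inE negb_or eq_sym => /andP[].
Qed.

(** One direction tests walks made of a single hyperedge; for the other, membership in D is constant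
    along any walk avoiding [i]. *)
Lemma carriesP T i D : i \notin D -> carries T i D <-> splits T i D.
Proof.
move=> iD; split=> [c|sp d j dD jD ji vs es [w [lst _]]].
  suff h e x y : e \in T -> x \in e -> y \in e -> x != i -> y != i -> x \in D -> y \in D.
    by move=> e x y eT xe ye xi yi; apply/idP/idP; apply: h eT _ _ _ _.
  move=> eT xe ye xi yi xD; apply/negPn/negP => yD.
  have xy : x != y by apply: contraNneq yD => <-.
  have sw : swalk T x y [:: y] [:: e] by rewrite /swalk /= inE xy.
  by have := c x y xD yD yi _ _ sw; rewrite !inE !(eq_sym i) (negPf xi) (negPf yi).
apply/negPn/negP => iw.
by have := splits_path sp (walk_path w) iw; rewrite lst dD (negPf jD).
Qed.

Lemma splits_setC T i D : splits T i D -> splits T i (~: [set i] :\: D).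
Proof.
move=> sp e x y eT xe ye xi yi; rewrite !inE xi yi !andbT.
by rewrite (sp e x y).
Qed.

Lemma splits_supp T k l : {in l, forall p, splits T p.1 p.2} -> splits T k (supp k l).
Proof.
move=> sp e x y eT xe ye xk yk; rewrite !inE; congr odd; apply: eq_in_count => p pl /=.
by case: eqVneq => //= pk; apply: sp eT xe ye _ _; rewrite ?pk.
Qed.

Definition conn T := forall u v, exists vs, [/\ path (adj T) u vs, last u vs = v & uniq (u :: vs)].

Lemma hypertree_conn T : is_hypertree T -> conn T.
Proof.
case=> _ h u v; have [[vs [es [w [lst [un _]]]]] _] := h u v.
by exists vs; split=> //; apply: walk_path w.
Qed.

(** * Commutation and normal form of partial conjugations avoiding a base vertex *)

Section Based.
Variables (T : hyp n) (b : 'I_n).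
Hypothesis cT : conn T.

(** A simple path from [b] to a point x of E must cross [k]. Its part from [k] to x avoids [i]:
    otherwise the part after [i], which avoids [k], would join a point outside E to x. So D is
    constant on that part. *)
Lemma splits_nested i D k E : i != k -> b \notin E -> splits T i D -> splits T k E ->
  i \notin E -> {in E, forall x, (x \in D) = (k \in D)}.
Proof.
move=> ik bE sD sE iE x xE; have [vs [pv lv uv]] := cT b x.
have kin : k \in b :: vs.
  by apply/negPn/negP => /(splits_path sE pv); rewrite lv xE (negPf bE).
have [q [pq lq uq]] : exists q, [/\ path (adj T) k q, last k q = x & uniq (k :: q)].
  move: kin; rewrite inE => /orP[/eqP kb|kvs]; first by exists vs; rewrite kb.
  case/splitPr: kvs pv lv uv => q1 q2; rewrite cat_path last_cat /= => /and3P[_ _ pq2] lq2.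
  by case/andP=> _; rewrite cat_uniq => /and3P[_ _ uq2]; exists q2.
have [iq|iq] := boolP (i \in k :: q); last by rewrite (splits_path sD pq iq) lq.
move: iq; rewrite inE (negPf ik) /= => iq.
case/splitPr: iq pq lq uq => q1 q2; rewrite cat_path last_cat /= => /and3P[_ _ pq2] lq2.
case/andP; rewrite mem_cat negb_or => /andP[_ kq] _.
by have := splits_path sE pq2 kq; rewrite lq2 xE (negPf iE).
Qed.

(** When [i] is outside E, [splits_nested] puts E and [k] both inside D or both outside it, and the
    two maps visibly commute. *)
Lemma pconj_comm i D k E : i \notin D -> k \notin E -> i != k ->
  b \notin D -> b \notin E -> splits T i D -> splits T k E ->
  ecomp (pconj i D) (pconj k E) = ecomp (pconj k E) (pconj i D).
Proof.
wlog iE : i k D E / i \notin E => [hw|] iD kE ik bD bE sD sE.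
  have [iE|iE] := boolP (i \in E); last exact: hw.
  have [kD|kD] := boolP (k \in D); last by symmetry; apply: hw => //; rewrite eq_sym.
  (* The case of [i] in E and [k] in D is impossible: a simple path from [b] to [k] meets [i] before
     [k], and this initial part would keep [i] outside E. *)
  have [vs [pv lv uv]] := cT b k.
  have : i \in b :: vs.
    by apply/negPn/negP => /(splits_path sD pv); rewrite lv kD (negPf bD).
  rewrite inE => /orP[/eqP ib|ivs]; first by move: bE; rewrite -ib iE.
  case/splitPr: ivs pv lv uv => q1 q2; rewrite -cat_rcons cat_path last_cat last_rcons.
  case/andP=> pq1 _ lq2; rewrite -cat_cons cat_uniq => /and3P[_ /hasPn h _].
  have kq : k \notin b :: rcons q1 i.
    case: q2 h lq2 => [|y q2] h lq2 /=; first by move: ik; rewrite -lq2 eqxx.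
    by apply: h; rewrite -lq2 /= mem_last.
  by have := splits_path sE pq1 kq; rewrite last_rcons iE (negPf bE).
have nest := splits_nested ik bE sD sE iE.
apply: eqE_eq => x; rewrite /ecomp {2 4}/pconj.
have [xE|xE] := boolP (x \in E).
  rewrite /apply /pconj (nest _ xE); have [kD|kD] := boolP (k \in D) => /=.
    rewrite (negPf iE) xE (nest _ xE) kD /=.
    by rewrite (reduce_iim [:: i; k]) (reduce_iim [:: i; k; x]).
  by rewrite (nest _ xE) (negPf kD) xE.
have [xD|xD] := boolP (x \in D).
  by rewrite /apply /pconj /= xD (negPf iE) (negPf xE).
by rewrite !apply_seq1 /pconj (negPf xD) (negPf xE).
Qed.

(** Keeping [b] out of D makes every factor fix the generator at [b], which leaves almost no freedom
    for inner automorphisms. *)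
Definition based p := [/\ p.1 \notin p.2, b \notin p.2 & splits T p.1 p.2].

Lemma based_wf l : {in l, forall p, based p} -> wf_list l.
Proof. by move=> bl; apply/allP => p /bl[]. Qed.

Lemma based_supp k l : {in l, forall p, based p} -> based (k, supp k l).
Proof.
move=> bl; split; last by apply: splits_supp => p /bl[].
  rewrite inE (_ : count _ _ = 0) //; apply/eqP; rewrite -leqn0 leqNgt -has_count.
  apply/hasPn => p /bl[pp _ _]; apply: contra pp => /andP[/eqP e].
  by rewrite e.
rewrite inE (_ : count _ _ = 0) //; apply/eqP; rewrite -leqn0 leqNgt -has_count.
by apply/hasPn => p /bl[_ bp _]; apply: contra bp => /andP[].
Qed.

(** The new factor commutes past the factors with letters other than [i], then merges with the one
    at [i] by symmetric difference. *)
Lemma pconj_prodpc_insert i D (F : 'I_n -> {set 'I_n}) s : based (i, D) ->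
  (forall k, based (k, F k)) -> uniq s -> i \in s ->
  ecomp (pconj i D) (prodpc [seq (k, F k) | k <- s]) =
  prodpc [seq (k, if k == i then symdiff D (F k) else F k) | k <- s].
Proof.
move=> bD bF; have [iD _ _] := bD.
have wf s' : wf_list [seq (k, F k) | k <- s'].
  by apply: based_wf => p /mapP[k _ ->].
elim: s => //= k s IH /andP[ks us]; rewrite inE; have [kF _ _] := bF k.
have ck := conj_type_pconj kF; have ci := conj_type_pconj iD.
have congs : k \notin s -> i == k ->
    [seq (k, if k == i then symdiff D (F k) else F k) | k <- s] = [seq (k, F k) | k <- s].
  move=> ks' /eqP ik; apply/eq_in_map => j js; case: eqVneq => // ji.
  by move: ks'; rewrite -ik -ji js.
have [ik _|ik /= i_s] := eqVneq i k.
  by rewrite congs // ?ik // -{3}ik -pconjM // -?ik // ecompA // ik.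
have [_ bk sk] := bF k; have [_ bD' sD] := bD.
rewrite -IH // ecompA // ecompA //; congr ecomp.
exact: pconj_comm.
Qed.

(** Sorting the factors by letter shows that a product of based factors depends only on its parity
    matrix. *)
Lemma prodpc_normal l : {in l, forall p, based p} ->
  prodpc l = prodpc [seq (k, supp k l) | k <- enum 'I_n].
Proof.
elim: l => [_|[i D] l IH bl].
  elim: (enum _) => //= k s <-; rewrite (_ : supp _ _ = set0).
    by rewrite pconj0 ecompi1 //; apply: conj_type_id.
  by apply/setP => x; rewrite !inE.
have bl' : {in l, forall p, based p} by move=> p pl; apply: bl; rewrite inE pl orbT.
rewrite /= IH // pconj_prodpc_insert ?enum_uniq ?mem_enum //.
- congr prodpc; apply: eq_map => k; congr pair; apply/setP => x.
  by rewrite [RHS]inE /= oddD; have [_|_] := eqVneq i k; rewrite !inE ?oddb.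
- by apply: bl; rewrite mem_head.
by move=> k; apply: based_supp.
Qed.

Lemma prodpc_supp0 l : {in l, forall p, based p} -> (forall k, supp k l = set0) ->
  prodpc l = @idE n.
Proof.
move=> bl s0; rewrite prodpc_normal //; elim: (enum _) => //= k s ->.
by rewrite s0 pconj0 ecompi1 //; apply: conj_type_id.
Qed.

(** A factor whose set contains [b] is replaced by the complementary one; the resulting inner
    automorphisms are moved to the left. *)
Lemma prodpc_based l : {in l, forall p, p.1 \notin p.2 /\ splits T p.1 p.2} ->
  exists w l', {in l', forall p, based p} /\ prodpc l = ecomp (inner w) (prodpc l').
Proof.
elim: l => [_|[i D] l IH sl].
  by exists [::], [::]; split=> //=; rewrite ecompi1 //; apply: conj_type_inner.
have [|w [l' [bl' el']]] := IH; first by move=> p pl; apply: sl; rewrite inE pl orbT.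
have [/= iD sD] := sl _ (mem_head _ _).
have cl' := conj_type_prodpc (based_wf bl').
have step D' : based (i, D') -> ecomp (pconj i D') (prodpc l) =
    ecomp (inner (apply (pconj i D') w)) (prodpc ((i, D') :: l')).
  case=> /= iD' _ _; have ci := conj_type_pconj iD'.
  by rewrite el' /= ecompA // ecomp_inner // -ecompA //; apply: conj_type_inner.
have ext D' : based (i, D') -> {in (i, D') :: l', forall p, based p}.
  by move=> b' p; rewrite inE => /orP[/eqP->//|/bl'].
have [bD|bD] := boolP (b \in D); last first.
  by exists (apply (pconj i D) w), ((i, D) :: l'); split; [exact: ext|exact: step].
have b' : based (i, ~: [set i] :\: D).
  by split; rewrite /= ?inE ?eqxx ?bD ?andbF //; apply: splits_setC.
exists (i :: apply (pconj i (~: [set i] :\: D)) w), ((i, ~: [set i] :\: D) :: l').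
split; first exact: ext.
rewrite /= pconj_setC // -[RHS]/(ecomp (inner ([:: i] ++ _)) (prodpc ((i, ~: [set i] :\: D) :: l'))).
rewrite -innerM -ecompA ?step // -?ecompA //; try exact: conj_type_inner.
Qed.

End Based.
End Carried.

(** * The vertex relations, with inner automorphisms made explicit *)

Section Moves.
Variable n : nat.
Implicit Types (T : hyp n) (phi psi chi : endo n) (u v w : seq 'I_n).
Implicit Types (p : 'I_n * {set 'I_n}) (l : seq ('I_n * {set 'I_n})).

Lemma carried_listP T l :
  carried_list T l <-> {in l, forall p, valid_pc p.1 p.2 /\ splits T p.1 p.2}.
Proof.
by split=> h p /h[v c]; split=> //; move: (v) c => /andP[iD _] /(carriesP _ iD).
Qed.

Lemma carried_wf T l : carried_list T l -> wf_list l.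
Proof. by move=> c; apply/allP => p /c[/andP[]]. Qed.

Lemma carried_cat T l l' : carried_list T l -> carried_list T l' -> carried_list T (l ++ l').
Proof. by move=> c c' p; rewrite mem_cat => /orP[/c|/c']. Qed.

(* [phi^-1 psi] is carried by [T] up to inner automorphisms. *)
Definition moves T phi psi := exists w l,
  carried_list T l /\ ecomp phi (prodpc l) = ecomp (inner w) psi.

Lemma vrelE (v w : vtx n) : vrel v w <-> v.2 = w.2 /\ moves v.2 v.1 w.1.
Proof.
split=> [[e [l [c [u /eqE_eq eu]]]]|[e [u [l [c eu]]]]]; split=> //.
  by exists u, l.
by exists l; split=> //; exists u => i; rewrite eu.
Qed.

Lemma vleE (v w : vtx n) : vle v w <-> ht_le v.2 w.2 /\ moves w.2 v.1 w.1.
Proof.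
split=> [[e [l [c [u /eqE_eq eu]]]]|[e [u [l [c eu]]]]]; split=> //.
  by exists u, l.
by exists l; split=> //; exists u => i; rewrite eu.
Qed.

Lemma moves_inner T w phi : conj_type phi -> moves T phi (ecomp (inner w) phi).
Proof.
move=> cp; exists (rev w), [::]; split=> //; have cw := @conj_type_inner n.
by rewrite ecompi1 // ecompA // innerVK ecomp1i.
Qed.

Lemma moves_prodpc T phi l : conj_type phi -> carried_list T l ->
  moves T phi (ecomp phi (prodpc l)).
Proof.
move=> cp c; exists [::], l; split=> //; rewrite inner_nil ecomp1i //.
by apply: conj_type_ecomp => //; apply: conj_type_prodpc (carried_wf c).
Qed.

Lemma moves_sym T phi psi : conj_type phi -> conj_type psi ->
  moves T phi psi -> moves T psi phi.
Proof.
move=> cphi cpsi [w [l [c e]]]; exists (rev w), (rev l).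
split=> [p|]; first by rewrite mem_rev => /c.
have wl := carried_wf c; have cl := conj_type_prodpc wl.
have cw := @conj_type_inner n.
have -> : psi = ecomp (inner (rev w)) (ecomp phi (prodpc l)).
  by apply: inner_cancel => //; apply: conj_type_ecomp.
by rewrite -ecompA // -[ecomp (ecomp phi _) _]ecompA // prodpcVK // ecompi1.
Qed.

Lemma moves_trans T phi psi chi : conj_type phi -> conj_type psi -> conj_type chi ->
  moves T phi psi -> moves T psi chi -> moves T phi chi.
Proof.
move=> cphi cpsi cchi [w [l [c e]]] [w' [l' [c' e']]]; exists (w ++ w'), (l ++ l').
split; first exact: carried_cat.
have wl := carried_wf c; have cl := conj_type_prodpc wl; have cw := @conj_type_inner n.
rewrite prodpc_cat ?(carried_wf c') // ecompA // e -ecompA // e' ecompA //.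
by rewrite innerM.
Qed.

Lemma moves_act T g phi psi : conj_type g -> conj_type phi -> conj_type psi ->
  moves T phi psi -> moves T (ecomp g phi) (ecomp g psi).
Proof.
move=> cg cphi cpsi [w [l [c e]]]; exists (apply g w), l; split=> //.
have cw := @conj_type_inner n.
by rewrite -ecompA // e ecompA // ecomp_inner // ecompA.
Qed.

End Moves.

(** * The inclusion of W_m in W_n and the retraction back *)

Section Lift.
Variables (m n : nat) (le_mn : m <= n).
Implicit Types (w : seq 'I_m) (x : seq 'I_n) (f g : endo n) (D : {set 'I_n}).

Definition lft (i : 'I_m) : 'I_n := widen_ord le_mn i.

Lemma lft_inj : injective lft.
Proof. by move=> i j /(congr1 val) /= /val_inj. Qed.

Lemma lftP (i : 'I_n) : (exists j, i = lft j) \/ m <= i.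
Proof.
case: (ltnP i m) => im; last by right.
by left; exists (Ordinal im); apply: val_inj.
Qed.

Lemma lft_lt j : (m <= lft j) = false.
Proof. by apply/negbTE; rewrite -ltnNge; apply: (ltn_ord j). Qed.

Lemma reduce_lft w : reduce (map lft w) = map lft (reduce w).
Proof.
elim: w => //= i w IH; rewrite !reduce_cons IH.
by case: (reduce w) => //= j t; rewrite (inj_eq lft_inj); case: ifP.
Qed.

Lemma conjw_lft w i : conjw (map lft w) (lft i) = map lft (conjw w i).
Proof. by rewrite /conjw -reduce_lft map_cat /= map_rev. Qed.

Lemma apply_lft (phi : endo m) (beta : endo n) w :
  (forall j, beta (lft j) = map lft (phi j)) -> apply beta (map lft w) = map lft (apply phi w).
Proof.
move=> e; rewrite /apply -reduce_lft; congr reduce.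
by elim: w => //= i w ->; rewrite e map_cat.
Qed.

(* The retraction killing the generators outside the range of [lft]. *)
Definition retr (w : seq 'I_n) : seq 'I_m := pmap (fun i : 'I_n => insub (val i)) w.

Lemma retr_cat x y : retr (x ++ y) = retr x ++ retr y.
Proof. exact: pmap_cat. Qed.

Lemma retr_cons_lft j x : retr (lft j :: x) = j :: retr x.
Proof. by rewrite /retr /= valK. Qed.

Lemma retr_cons_ge (i : 'I_n) x : m <= i -> retr (i :: x) = retr x.
Proof. by move=> mi; rewrite /retr /= insubF // ltnNge mi. Qed.

Lemma retr_lft w : retr (map lft w) = w.
Proof. by elim: w => // i w IH; rewrite map_cons retr_cons_lft IH. Qed.

Lemma retr_rev x : retr (rev x) = rev (retr x).
Proof.
elim: x => // i x IH; rewrite rev_cons -cats1 retr_cat IH.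
case: (lftP i) => [[j ->]|mi]; first by rewrite !retr_cons_lft rev_cons cats1.
by rewrite !retr_cons_ge // cats0.
Qed.

Lemma retr_reduce x : reduce (retr (reduce x)) = reduce (retr x).
Proof.
elim: x => // i x IH; rewrite reduce_cons.
have -> : reduce (retr (push i (reduce x))) = reduce (retr (i :: reduce x)).
  case: (reduce x) => [|j t] //; rewrite [push _ _]/=; case: eqP => // <-.
  case: (lftP i) => [[k ->]|mi]; first by rewrite !retr_cons_lft reduce_ii.
  by rewrite !retr_cons_ge.
case: (lftP i) => [[k ->]|mi]; first by rewrite !retr_cons_lft !reduce_cons IH.
by rewrite !retr_cons_ge.
Qed.

Lemma retr_conjw_lft x j : reduce (retr (conjw x (lft j))) = conjw (retr x) j.
Proof. by rewrite retr_reduce retr_cat retr_cons_lft retr_rev. Qed.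

Lemma retr_conjw_ge x (i : 'I_n) : m <= i -> reduce (retr (conjw x i)) = [::].
Proof.
move=> mi; rewrite retr_reduce retr_cat retr_cons_ge // retr_rev.
by rewrite -[rev _]cats0 reduce_cat_rev.
Qed.

Lemma lft_retr x : {in x, forall i : 'I_n, i < m} -> map lft (retr x) = x.
Proof.
elim: x => // i x IH h; case: (lftP i) => [[j ej]|]; last by rewrite leqNgt h ?mem_head.
by rewrite ej retr_cons_lft /= IH // => k kx; apply: h; rewrite inE kx orbT.
Qed.

Definition endo_retr (f : endo n) : endo m := fun j => reduce (retr (f (lft j))).

(** A killed generator is sent to a conjugate of itself, which dies too; hence [f] descends to the
    quotient W_m, where it is [endo_retr f]. *)
Lemma apply_retr f x : conj_type f -> reduce (retr (apply f x)) = apply (endo_retr f) (retr x).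
Proof.
move=> cf; elim: x => // i x IH; rewrite apply_cons retr_reduce retr_cat.
rewrite -reduce_catr IH; case: (lftP i) => [[j ->]|mi].
  by rewrite retr_cons_lft apply_cons /endo_retr [RHS]reduce_catl.
rewrite retr_cons_ge // -reduce_catl; have [u ->] := cf i.
by rewrite retr_conjw_ge // reduce_id // apply_reduced.
Qed.

Lemma endo_retrM f g : conj_type f -> endo_retr (ecomp f g) = ecomp (endo_retr f) (endo_retr g).
Proof.
move=> cf; apply: eqE_eq => j; rewrite /endo_retr /ecomp apply_retr //.
rewrite apply_reduce // => k; have [u e] := cf (lft k).
by exists (retr u); rewrite /endo_retr e retr_conjw_lft.
Qed.

Lemma endo_retr_conj_type f : conj_type f -> conj_type (endo_retr f).
Proof. by move=> cf k; have [u e] := cf (lft k); exists (retr u); rewrite /endo_retr e retr_conjw_lft. Qed.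

Lemma endo_retr_inner x : endo_retr (inner x) = inner (retr x).
Proof. by apply: eqE_eq => j; rewrite /endo_retr retr_conjw_lft. Qed.

Lemma endo_retr_id : endo_retr (@idE n) = @idE m.
Proof. by rewrite -!inner_nil endo_retr_inner. Qed.

Lemma endo_retr_pconj_ge (i : 'I_n) D : i \notin D -> m <= i -> endo_retr (pconj i D) = @idE m.
Proof.
move=> iD mi; apply: eqE_eq => j; rewrite /endo_retr /pconj; case: ifP => _.
  by rewrite retr_cons_ge // retr_cons_lft retr_cons_ge.
by rewrite retr_cons_lft.
Qed.

Lemma endo_retr_pconj_lft i D : lft i \notin D ->
  endo_retr (pconj (lft i) D) = pconj i (lft @^-1: D).
Proof.
move=> iD; apply: eqE_eq => j; rewrite /endo_retr /pconj inE; case: ifP => jD.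
  rewrite !retr_cons_lft reduce_id // /reduced /= andbT eq_sym andbb.
  by apply: contraNneq iD => <-.
by rewrite retr_cons_lft.
Qed.

End Lift.

(** * Extension from [W_4] to [W_n] *)

Section Extension.
Variables (n : nat) (le4n : 4 <= n).
Notation lft := (lft le4n).
Notation o4 := (ord0 : 'I_4).
Implicit Types (phi psi chi : endo 4) (beta gamma : endo n) (T L : hyp 4).
Implicit Types (w u : seq 'I_4) (f x : 'I_n) (D : {set 'I_4}).

Lemma map_val_lft w : map val (map lft w) = map val w.
Proof. by rewrite -map_comp. Qed.

Lemma lft_val (j : 'I_4) x : val j = val x -> x = lft j.
Proof. by move=> e; apply: val_inj; rewrite -e. Qed.

Lemma ext_relP phi beta : ext_rel phi beta <->
  (forall j, beta (lft j) = map lft (phi j)) /\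
  (forall f, 4 <= f -> exists u, phi o4 = conjw u o4 /\ beta f = conjw (map lft u) f).
Proof.
have vi := inj_map (@val_inj _ _ 'I_n).
split=> [[h1 h2]|[h1 h2]]; split.
- by move=> j; apply: vi; rewrite map_val_lft; apply: h1.
- move=> f /h2[o [u [u' [o0 eo eu eb]]]]; exists u.
  have eo4 : o = o4 by apply: val_inj.
  rewrite eo4 in eo; split=> //; rewrite eb; congr conjw.
  by apply: vi; rewrite map_val_lft.
- by move=> j x /lft_val ->; rewrite h1 map_val_lft.
- by move=> f /h2[u [e1 e2]]; exists o4, u, (map lft u); rewrite map_val_lft.
Qed.

Lemma ext_conj_type phi beta : conj_type phi -> ext_rel phi beta -> conj_type beta.
Proof.
move=> cp /ext_relP[h1 h2] x; case: (lftP le4n x) => [[j ->]|/h2[u [_ ->]]]; last by eexists.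
by have [u e] := cp j; exists (map lft u); rewrite h1 e conjw_lft.
Qed.

Lemma ext_exists phi : conj_type phi -> exists beta : endo n, ext_rel phi beta.
Proof.
move=> cp; have [u eu] := cp o4.
exists (fun x => if insub (val x) is Some j then map lft (phi j) else conjw (map lft u) x).
apply/ext_relP; split=> [j|f fF]; first by rewrite /= valK.
by exists u; rewrite insubF // ltnNge fF.
Qed.

Lemma ext_ecomp chi phi beta gamma : conj_type chi -> conj_type phi ->
  ext_rel chi beta -> ext_rel phi gamma -> ext_rel (ecomp chi phi) (ecomp beta gamma).
Proof.
move=> cc cp ecb epg; have cb := ext_conj_type cc ecb.
move/ext_relP: ecb epg => [b1 b2] /ext_relP[g1 g2].
apply/ext_relP; split=> [j|f fF]; first by rewrite /ecomp g1 (apply_lft _ b1).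
have [u [eu gu]] := g2 f fF; have [v [ev bv]] := b2 f fF.
exists (apply chi u ++ v); rewrite /ecomp eu gu (apply_conjw _ cc ev) (apply_conjw _ cb bv).
by rewrite map_cat (apply_lft _ b1).
Qed.

Lemma ext_inner w : ext_rel (inner w) (inner (map lft w) : endo n).
Proof.
apply/ext_relP; split=> [j|f fF]; first by rewrite /inner conjw_lft.
by exists w.
Qed.

Lemma ext_id : ext_rel (@idE 4) (@idE n).
Proof. exact: (ext_inner [::]). Qed.

Lemma reduce_rev_solve m (u v x : seq 'I_m) :
  reduce (rev u ++ v) = reduce x -> reduce v = reduce (u ++ x).
Proof. by move=> e; rewrite -reduce_catr -e reduce_catr reduce_cat_rev. Qed.

Lemma pconj_in m (i j : 'I_m) (D : {set 'I_m}) : i \notin D -> j \in D ->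
  pconj i D j = conjw [:: i] j.
Proof.
move=> iD jD; have := conj_type_reduced j (conj_type_pconj iD).
by rewrite /pconj jD => /reduce_id.
Qed.

(** The conjugator [u] of a_1 is only defined up to a_1 on the right. S collects the a_f on which
    the two extensions chose differently, and precomposing with x_{1,S} inserts the missing a_1. *)
Lemma ext_unique phi beta gamma : conj_type phi -> ext_rel phi beta -> ext_rel phi gamma ->
  exists S : {set 'I_n}, (forall f, f \in S -> 4 <= f) /\
    gamma = ecomp beta (pconj (lft o4) S).
Proof.
move=> cp eb eg; have cb := ext_conj_type cp eb; have cg := ext_conj_type cp eg.
move/ext_relP: eb eg => [b1 b2] /ext_relP[g1 g2].
pose S : {set 'I_n} := [set f : 'I_n | (4 <= f) && (gamma f != beta f)].
have lS j : lft j \notin S by rewrite inE lft_lt.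
exists S; split; first by move=> f; rewrite inE => /andP[].
apply: eqE_eq => x; rewrite /ecomp; have [xS|xS] := boolP (x \in S); last first.
  rewrite /pconj (negPf xS) apply_seq1 reduce_id ?conj_type_reduced //.
  case: (lftP le4n x) => [[j ->]|xF]; first by rewrite b1 g1.
  by move: xS; rewrite inE xF negbK => /eqP.
rewrite pconj_in //; move: xS; rewrite inE => /andP[xF ne].
have [u [eu bu]] := b2 x xF; have [v [ev gv]] := g2 x xF.
rewrite (apply_conjw _ cb bu) apply_seq1 b1 eu.
have := conjw_inj (etrans (esym ev) eu).
have cong w w' : reduce w = reduce w' -> conjw (map lft w) x = conjw (map lft w') x.
  by move=> e; rewrite -conjw_reduce reduce_lft e -reduce_lft conjw_reduce.
case=> e; first by move: ne; rewrite bu gv (cong v u) ?eqxx // (@reduce_rev_solve _ u v [::]) ?cats0.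
rewrite gv (cong v (u ++ [:: o4])); last exact: reduce_rev_solve.
(* The conjugator obtained from [beta] is (u a_1 u^-1) u, which reduces to u a_1. *)
rewrite -[RHS]conjw_reduce reduce_catl -map_cat reduce_lft -reduce_lft conjw_reduce.
apply: cong; rewrite /conjw reduce_catl -catA /=.
by rewrite -[in RHS]cat_rcons -[in RHS]reduce_catr -[rev u ++ u]cats0 -catA reduce_rev_cat cats0 cats1.
Qed.

(** Extend the inverse of [phi] to [gamma]. Both composites of [beta] and [gamma] extend the
    identity, so they are involutions x_{1,S} and x_{1,S'}, which correct [gamma] to a right and a
    left inverse; these coincide. *)
Lemma ext_aut phi beta : is_aut0 phi -> ext_rel phi beta -> is_aut0 beta.
Proof.
move=> [cp [psi [cs [/eqE_eq e1 /eqE_eq e2]]]] eb.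
have [gamma eg] := ext_exists cs.
have cb := ext_conj_type cp eb; have cg := ext_conj_type cs eg.
have h1 := ext_ecomp cp cs eb eg; have h2 := ext_ecomp cs cp eg eb.
rewrite e1 in h1; rewrite e2 in h2.
have [S [FS eS]] := ext_unique (@conj_type_id 4) h1 ext_id.
have [S' [FS' eS']] := ext_unique (@conj_type_id 4) h2 ext_id.
have oS : lft o4 \notin S by apply/negP => /FS; rewrite lft_lt.
have oS' : lft o4 \notin S' by apply/negP => /FS'; rewrite lft_lt.
have cS := conj_type_pconj oS; have cS' := conj_type_pconj oS'.
pose p := pconj (lft o4) S; pose p' := pconj (lft o4) S'.
have cgb := conj_type_ecomp cg cb.
have right_inv : ecomp beta (ecomp gamma p) = @idE n by rewrite ecompA.
have left_inv : ecomp (ecomp p' gamma) beta = @idE n.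
  rewrite -ecompA //; have -> : ecomp gamma beta = p'.
    rewrite -(ecompi1 cgb) -(pconjK oS') ecompA // -eS' ecomp1i //.
  exact: pconjK.
have e : ecomp gamma p = ecomp p' gamma.
  have cgp : conj_type (ecomp gamma p) by apply: conj_type_ecomp.
  have cpg : conj_type (ecomp p' gamma) by apply: conj_type_ecomp.
  by rewrite -[LHS]ecomp1i // -left_inv -ecompA // right_inv ecompi1.
split=> //; exists (ecomp gamma p); split; first exact: conj_type_ecomp.
by split; [rewrite right_inv | rewrite e left_inv].
Qed.

(** Unlike [retr], which kills the extra letters, this map of vertices collapses each leaf onto its
    attaching vertex 1. *)
Definition retract (x : 'I_n) : 'I_4 := if insub (val x) is Some j then j else ord0.

Lemma retract_lft j : retract (lft j) = j.
Proof. by rewrite /retract /= valK. Qed.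

Lemma retract_ge x : 4 <= x -> retract x = ord0.
Proof. by move=> xF; rewrite /retract insubF // ltnNge xF. Qed.

(** The a_f follow a_1, so F joins D when D contains 1. In that case the outer class is still that
    of x_{i,D'} with D' the complement of D in the first four vertices other than i. *)
Lemma ext_pconj i D : i \notin D -> ext_rel (pconj i D) (pconj (lft i) (retract @^-1: D)).
Proof.
move=> iD; have iD' : lft i \notin retract @^-1: D by rewrite inE retract_lft.
apply/ext_relP; split=> [j|f fF].
  by rewrite /pconj inE retract_lft; case: ifP.
have [oD|oD] := boolP (o4 \in D).
  by exists [:: i]; rewrite !pconj_in // inE retract_ge.
by exists [::]; rewrite /pconj inE retract_ge // (negPf oD).
Qed.

Lemma tildeP T (X : {set 'I_n}) : reflect
  ((exists2 E, E \in T & X = lft @: E) \/ (exists2 f : 'I_n, 4 <= f & X = [set lft o4; f]))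
  (X \in tilde n T).
Proof.
have e1 (E : {set 'I_4}) :
    [set x : 'I_n | [exists y : 'I_4, (y \in E) && (val y == val x)]] = lft @: E.
  apply/setP => x; rewrite inE; apply/existsP/imsetP => [[y /andP[yE /eqP/lft_val ->]]|[y yE ->]].
    by exists y.
  by exists y; rewrite yE /=.
have e2 (f : 'I_n) : [set x : 'I_n | (val x == 0) || (x == f)] = [set lft o4; f].
  by apply/setP => x; rewrite !inE.
rewrite /tilde inE; apply: (iffP orP) => [[]/imsetP[E]|[[E ET ->]|[f fF ->]]].
- by rewrite e1; left; exists E.
- by rewrite e2 inE; right; exists E.
- by left; rewrite -e1; apply: imset_f.
by right; rewrite -e2; apply: imset_f; rewrite inE.
Qed.

Lemma splits_tilde_retract T i D : i \notin D -> splits T i D ->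
  splits (tilde n T) (lft i) (retract @^-1: D).
Proof.
move=> iD sp X x y /tildeP[[E ET ->]|[f fF ->]].
  move=> /imsetP[a aE ->] /imsetP[b bE ->]; rewrite !(inj_eq (@lft_inj _ _ _)) !inE !retract_lft.
  exact: sp ET aE bE.
suff h z : z \in [set lft o4; f] -> retract z = o4 by move=> /h hx /h hy _ _; rewrite !inE hx hy.
by rewrite !inE => /orP[/eqP->|/eqP->]; rewrite ?retract_lft ?retract_ge.
Qed.

Lemma splits_tilde_lft T i (D : {set 'I_n}) : splits (tilde n T) (lft i) D ->
  splits T i (lft @^-1: D).
Proof.
move=> sp E a b ET aE bE ai bi; rewrite !inE.
apply: (sp (lft @: E)); rewrite ?(inj_eq (@lft_inj _ _ _)) ?imset_f //.
by apply/tildeP; left; exists E.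
Qed.

Lemma splits_tilde_F T (S : {set 'I_n}) : (forall f, f \in S -> 4 <= f) ->
  splits (tilde n T) (lft o4) S.
Proof.
move=> FS X x y /tildeP[[E ET ->]|[f fF ->]].
  have lS j : lft j \notin S by apply/negP => /FS; rewrite lft_lt.
  by move=> /imsetP[a _ ->] /imsetP[b _ ->]; rewrite !(negPf (lS _)).
by rewrite !inE => /orP[/eqP->|/eqP->] /orP[/eqP->|/eqP->]; rewrite ?eqxx.
Qed.

Lemma carried_tilde_F T (S : {set 'I_n}) : (forall f, f \in S -> 4 <= f) ->
  exists l, carried_list (tilde n T) l /\ prodpc l = pconj (lft o4) S.
Proof.
move=> FS; have oS : lft o4 \notin S by apply/negP => /FS; rewrite lft_lt.
have [->|S0] := eqVneq S set0; first by exists [::]; rewrite pconj0.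
exists [:: (lft o4, S)]; rewrite prodpc1 //; split=> //.
apply/carried_listP => p; rewrite inE => /eqP ->; rewrite /valid_pc oS S0.
by split=> //; apply: splits_tilde_F.
Qed.

Lemma moves_ext_same T phi beta gamma : conj_type phi -> ext_rel phi beta ->
  ext_rel phi gamma -> moves (tilde n T) beta gamma.
Proof.
move=> cp eb eg; have [S [FS ->]] := ext_unique cp eb eg.
have [l [cl <-]] := carried_tilde_F T FS.
by apply: moves_prodpc => //; apply: ext_conj_type eb.
Qed.

Lemma ext_prodpc T l : carried_list T l ->
  exists l', carried_list (tilde n T) l' /\ ext_rel (prodpc l) (prodpc l').
Proof.
elim: l => [_|[i D] l IH cl]; first by exists [::]; split=> //; apply: ext_id.
have [|l' [cl' el]] := IH; first by move=> p pl; apply: cl; rewrite inE pl orbT.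
have /carried_listP/(_ _ (mem_head _ _)) /=[/andP[iD D0] sD] := cl.
exists ((lft i, retract @^-1: D) :: l'); split.
  apply/carried_listP => p; rewrite inE => /orP[/eqP->|]; last by move: p; apply/carried_listP.
  split; last exact: splits_tilde_retract.
  rewrite /valid_pc inE retract_lft iD /=; case/set0Pn: D0 => x xD.
  by apply/set0Pn; exists (lft x); rewrite inE retract_lft.
apply: ext_ecomp => //; first exact: conj_type_pconj.
  by apply/conj_type_prodpc/(@carried_wf _ T) => p pl; apply: cl; rewrite inE pl orbT.
exact: ext_pconj.
Qed.

(** Extending the equation between [phi] and [psi] factor by factor gives two extensions of one map;
    they differ by an element of G, which [tilde n T] carries. *)
Lemma moves_tilde T phi psi beta gamma : conj_type phi -> conj_type psi ->
  ext_rel phi beta -> ext_rel psi gamma -> moves T phi psi -> moves (tilde n T) beta gamma.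
Proof.
move=> cp cs eb eg [w [l [cl e]]]; have [l' [cl' el']] := ext_prodpc cl.
have cpl := conj_type_prodpc (carried_wf cl); have cpl' := conj_type_prodpc (carried_wf cl').
have cb := ext_conj_type cp eb; have cg := ext_conj_type cs eg.
have h1 := ext_ecomp cp cpl eb el'; rewrite e in h1.
have h2 := ext_ecomp (@conj_type_inner _ w) cs (ext_inner w) eg.
have ci := @conj_type_inner n (map lft w).
have h3 := moves_ext_same T (conj_type_ecomp (@conj_type_inner _ w) cs) h1 h2.
apply: moves_trans (moves_prodpc cb cl') _ => //; first exact: conj_type_ecomp.
apply: moves_trans h3 _ => //; try exact: conj_type_ecomp.
by apply: moves_sym => //; [exact: conj_type_ecomp | apply: moves_inner].
Qed.

Lemma endo_retr_ext phi beta : conj_type phi -> ext_rel phi beta -> endo_retr le4n beta = phi.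
Proof.
move=> cp /ext_relP[h _]; apply: eqE_eq => j.
by rewrite /endo_retr h retr_lft reduce_id // conj_type_reduced.
Qed.

Lemma endo_retr_prodpc T l : carried_list (tilde n T) l ->
  exists l', carried_list T l' /\ endo_retr le4n (prodpc l) = prodpc l'.
Proof.
elim: l => [_|[x D] l IH cl]; first by exists [::]; rewrite endo_retr_id.
have cl0 : carried_list (tilde n T) l by move=> p pl; apply: cl; rewrite inE pl orbT.
have [l' [cl' el]] := IH cl0; have cpl' := conj_type_prodpc (carried_wf cl').
have /carried_listP/(_ _ (mem_head _ _)) /=[/andP[xD _] sD] := cl.
rewrite /= endo_retrM ?el; last exact: conj_type_pconj.
case: (lftP le4n x) xD sD => [[i ->]|xF] xD sD; last first.
  by exists l'; rewrite endo_retr_pconj_ge // ecomp1i.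
rewrite endo_retr_pconj_lft //.
(* A set consisting of killed vertices only retracts to the empty set, which is not a valid factor
   and is dropped. *)
have [D0|D0] := eqVneq (lft @^-1: D) set0; first by exists l'; rewrite D0 pconj0 ecomp1i.
exists ((i, lft @^-1: D) :: l'); split=> //; apply/carried_listP => p.
rewrite inE => /orP[/eqP->|]; last by move: p; apply/carried_listP.
by split; [rewrite /valid_pc inE xD D0 | apply: splits_tilde_lft].
Qed.

Lemma moves_tilde_inv T phi psi beta gamma : conj_type phi -> conj_type psi ->
  ext_rel phi beta -> ext_rel psi gamma -> moves (tilde n T) beta gamma -> moves T phi psi.
Proof.
move=> cp cs eb eg [w [l [cl e]]].
have cb := ext_conj_type cp eb.
have [l' [cl' el']] := endo_retr_prodpc cl.
exists (retr 4 w), l'; split=> //; move/(congr1 (endo_retr le4n)): e.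
rewrite !endo_retrM //; last exact: conj_type_inner.
by rewrite el' endo_retr_inner (endo_retr_ext cp eb) (endo_retr_ext cs eg).
Qed.

End Extension.

(** * The hypertrees [tilde n T] *)

Section Tilde.
Variables (n : nat) (le4n : 4 <= n).
Notation lft := (lft le4n).
Notation o4 := (ord0 : 'I_4).
Notation stem f := ([set lft o4; f]).
Notation lfts E := (lft @: (E : {set 'I_4})).
Implicit Types (T L : hyp 4) (X Y : hyp n) (f x y : 'I_n) (E : {set 'I_4}) (e : {set 'I_n}).

Let lftI : injective lft := @lft_inj _ _ le4n.
Let lftsI : injective (fun E => lfts E) := imset_inj lftI.

Definition untilde X : hyp 4 := [set E : {set 'I_4} | lfts E \in X].

Lemma lft_set_lt E x : x \in lfts E -> x < 4.
Proof. by case/imsetP => y _ ->; apply: (ltn_ord y). Qed.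

Lemma lft_set_preim e : {in e, forall x, x < 4} -> e = lfts (lft @^-1: e).
Proof.
move=> h; apply/setP => x; apply/idP/imsetP => [xe|[y]]; last by rewrite inE => ye ->.
by case: (lftP le4n x) => [[j ej]|]; [exists j; rewrite // inE -ej | rewrite leqNgt h].
Qed.

Lemma stem_neq E f : 4 <= f -> lfts E != stem f.
Proof.
by move=> fF; apply/eqP => /setP/(_ f); rewrite !inE eqxx orbT => /lft_set_lt; rewrite ltnNge fF.
Qed.

Lemma stem_inj f f' : 4 <= f -> stem f = stem f' -> f = f'.
Proof.
move=> fF /setP/(_ f); rewrite !inE eqxx orbT => /esym/orP[/eqP ef|/eqP //].
by move: fF; rewrite ef lft_lt.
Qed.

Lemma tilde_lft T E : (lfts E \in tilde n T) = (E \in T).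
Proof.
apply/(tildeP le4n)/idP => [[[E' ET /lftsI ->]//|[f fF ef]]|ET]; last by left; exists E.
by have := stem_neq E fF; rewrite ef eqxx.
Qed.

Lemma tilde_stem T f : 4 <= f -> stem f \in tilde n T.
Proof. by move=> fF; apply/(tildeP le4n); right; exists f. Qed.

Lemma tildeK T : untilde (tilde n T) = T.
Proof. by apply/setP => E; rewrite inE tilde_lft. Qed.

Lemma untildeK X : (forall f, 4 <= f -> stem f \in X) ->
  {in X, forall e, {in e, forall x, x < 4} \/ exists2 f : 'I_n, 4 <= f & e = stem f} ->
  tilde n (untilde X) = X.
Proof.
move=> h1 h2; apply/setP => e; apply/(tildeP le4n)/idP => [[[E + ->]|[f fF ->]]|eX].
- by rewrite inE.
- exact: h1.
have [he|] := h2 e eX; last by right.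
by left; exists (lft @^-1: e); rewrite ?inE -lft_set_preim.
Qed.

(** * Folds of the extended hypertrees *)

Lemma untilde_fold X E1 E2 :
  untilde (X :\ lfts E1 :\ lfts E2 :|: [set lfts E1 :|: lfts E2]) =
  untilde X :\ E1 :\ E2 :|: [set E1 :|: E2].
Proof. by apply/setP => E; rewrite !inE -imsetU !(inj_eq lftsI). Qed.

Lemma fold1_tilde L T : fold1 L T -> fold1 (tilde n L) (tilde n T).
Proof.
case=> E1 [E2 [E1L E2L ne ni ->]]; exists (lfts E1), (lfts E2).
split; rewrite ?tilde_lft ?(inj_eq lftsI) //.
  case/set0Pn: ni => x; rewrite inE => /andP[x1 x2].
  by apply/set0Pn; exists (lft x); rewrite inE !imset_f.
rewrite -{1}(tildeK L) -untilde_fold untildeK // => [f fF|e].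
  by rewrite in_setU !in_setD1 in_set1 !(eq_sym (stem _)) !stem_neq // tilde_stem.
rewrite in_setU !in_setD1 in_set1 => /orP[/and3P[_ _ /(tildeP le4n)[[E _ ->]|]]|/eqP ->]; last 1 first.
- by left=> x; rewrite inE => /orP[]; apply: lft_set_lt.
- by left=> x; apply: lft_set_lt.
by right.
Qed.

Lemma folds_tilde L T : folds_to L T -> folds_to (tilde n L) (tilde n T).
Proof.
elim=> [|T1 T2 _ IH f1]; first exact: ft_refl.
exact: ft_step IH (fold1_tilde f1).
Qed.

Lemma folds_card X Y : folds_to X Y -> {in X, forall e, 2 <= #|e|} ->
  {in Y, forall e, 2 <= #|e|}.
Proof.
move=> + hX; elim=> // Y1 Y2 _ IH [e1 [e2 [h1 h2 _ _ ->]]] e.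
rewrite !inE => /orP[/and3P[_ _]|/eqP ->]; first exact: IH.
exact: leq_trans (IH _ h1) (subset_leq_card (subsetUl _ _)).
Qed.

Lemma tilde_card T : {in T, forall E, 2 <= #|E|} -> {in tilde n T, forall e, 2 <= #|e|}.
Proof.
move=> h e /(tildeP le4n)[[E ET ->]|[f fF ->]]; first by rewrite card_imset //; apply: h.
by rewrite cards2; case: eqP => // ef; move: fF; rewrite -ef lft_lt.
Qed.

(** No fold can produce a two-element hyperedge, since it merges two distinct hyperedges of size at
    least 2. So, going back from the last fold, only hyperedges within the first four vertices are
    merged and every intermediate stage is again some [tilde]. *)
Lemma folds_tilde_inv L T : {in L, forall E, 2 <= #|E|} ->
  folds_to (tilde n L) (tilde n T) -> folds_to L T.
Proof.
move=> /tilde_card hL; move eY: (tilde n T) => Y fY; elim: fY T eY => [|Y1 Y2 f1 IH fold] T eY.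
  by rewrite -(tildeK T) eY tildeK; apply: ft_refl.
have hY := folds_card f1 hL.
have [e1 [e2 [e1Y e2Y ne ni eY2]]] := fold.
have : e1 :|: e2 \in tilde n T by rewrite eY eY2 !inE eqxx orbT.
have sub1 := subsetUl e1 e2; have sub2 := subsetUr e1 e2.
case/(tildeP le4n) => [[E ET eU]|[f fF eU]]; last first.
  have full e : e \in Y1 -> e \subset e1 :|: e2 -> e = stem f.
    move=> eY1 es; apply/eqP; rewrite eqEcard -eU es eU cards2.
    by apply: leq_trans (hY e eY1); case: (_ != _).
  by move: ne; rewrite (full e1) // (full e2) // eqxx.
have lt1 : {in e1, forall x, x < 4}.
  by move=> x xe; apply: (@lft_set_lt E); rewrite -eU (subsetP sub1).
have lt2 : {in e2, forall x, x < 4}.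
  by move=> x xe; apply: (@lft_set_lt E); rewrite -eU (subsetP sub2).
have eY1 : tilde n (untilde Y1) = Y1.
  apply: untildeK => [f fF|e eY1].
    have := tilde_stem T fF; rewrite eY eY2 eU in_setU in_set1 (eq_sym _ (lfts E)).
    by rewrite (negPf (stem_neq E fF)) orbF !in_setD1 => /and3P[].
  have [->|n1] := eqVneq e e1; first by left.
  have [->|n2] := eqVneq e e2; first by left.
  have : e \in tilde n T by rewrite eY eY2 !inE n1 n2 eY1.
  by case/(tildeP le4n) => [[E' _ ->]|]; [left=> x; apply: lft_set_lt | right].
apply: ft_step (IH _ eY1) _.
rewrite -(tildeK T) eY eY2 (lft_set_preim lt1) (lft_set_preim lt2) untilde_fold.
exists (lft @^-1: e1), (lft @^-1: e2).
rewrite !inE -(lft_set_preim lt1) -(lft_set_preim lt2); split=> //.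
  by apply: contraNneq ne => e12; rewrite (lft_set_preim lt1) e12 -lft_set_preim.
case/set0Pn: ni => x; rewrite inE => /andP[x1 x2]; apply/set0Pn; exists (inord x).
have ex : lft (inord x) = x by apply: val_inj; rewrite /= inordK // lt1.
by rewrite !inE ex x1 x2.
Qed.

(** The vertices beyond the first four can only hang from vertex 1; presence of the hyperedges {1,
    f} is not included. *)
Definition leafy X := forall e f, e \in X -> f \in e -> 4 <= f -> e = stem f.

Lemma tilde_leafy T : leafy (tilde n T).
Proof.
move=> e f /(tildeP le4n)[[E _ ->] /lft_set_lt|[f' f'F ->]]; first by move=> + fF; rewrite ltnNge fF.
by rewrite !inE => /orP[] /eqP -> //; rewrite lft_lt.
Qed.

(** * Simple walks in hypertrees with leaves at vertex 1 *)

Lemma walk_rcons X u vs x es e : walk_ok X u (rcons vs x) (rcons es e) <->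
  walk_ok X u vs es /\ e \in X /\ last u vs \in e /\ x \in e.
Proof.
elim: vs u es => [|v vs IH] u [|e' es] /=; try by [tauto|case: es => /=; tauto].
  by case: vs {IH} => /=; tauto.
by rewrite IH; tauto.
Qed.

Lemma walk_lft X u vs es :
  walk_ok X (lft u) (map lft vs) (map (fun E => lfts E) es) <-> walk_ok (untilde X) u vs es.
Proof.
elim: vs u es => [|v vs IH] u [|E es] //=.
by rewrite inE !(mem_imset _ _ lftI) IH.
Qed.

Lemma swalk_lft X u v vs es :
  swalk X (lft u) (lft v) (map lft vs) (map (fun E => lfts E) es) <->
  swalk (untilde X) u v vs es.
Proof.
rewrite /swalk walk_lft last_map -map_cons (map_inj_uniq lftI) (map_inj_uniq lftsI).
by split=> [[? [/lftI]]|[? [->]]].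
Qed.

(** A walk entering a leaf would have to leave it by the same hyperedge, and a stem has only one
    vertex among the first four, so it cannot join two distinct ones. *)
Lemma walk_range X u vs es : leafy X -> walk_ok X u vs es -> uniq (u :: vs) -> uniq es ->
  u < 4 -> last u vs < 4 -> exists vs' es', vs = map lft vs' /\ es = map (fun E => lfts E) es'.
Proof.
move=> lX; elim: vs u es => [|v vs IH] u [|e es] //=; first by exists [::], [::].
move=> [eX [ue [ve w]]] /andP[uv un] /andP[ees ues] u4 l4.
have v4 : v < 4.
  rewrite ltnNge; apply/negP => vF; have ev := lX e v eX ve vF.
  case: vs w l4 {IH un uv} => [|v2 vs] w l4; first by rewrite /= ltnNge vF in l4.
  case: es w ees {ues} => //= e2 es [e2X [ve2 _]].
  by rewrite inE (lX e2 v e2X ve2 vF) -ev eqxx.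
have e4 : {in e, forall x, x < 4}.
  move=> x xe; rewrite ltnNge; apply/negP => xF; have ex := lX e x eX xe xF.
  have z y : y \in e -> y < 4 -> y = lft o4.
    by rewrite ex !inE => /orP[/eqP //|/eqP ->]; rewrite ltnNge xF.
  by move: uv; rewrite (z u) // (z v) // mem_head.
have [vs' [es' [-> ->]]] := IH v es w un ues v4 l4.
case: (lftP le4n v) => [[j ->]|]; last by rewrite leqNgt v4.
by exists (j :: vs'), ((lft @^-1: e) :: es'); rewrite /= -lft_set_preim.
Qed.

Lemma swalk_range X u v vs es : leafy X -> swalk X (lft u) (lft v) vs es ->
  exists vs' es', [/\ vs = map lft vs', es = map (fun E => lfts E) es' &
                      swalk (untilde X) u v vs' es'].
Proof.
move=> lX sw; have [w [lst [un ues]]] := sw.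
have l4 : last (lft u) vs < 4 by rewrite lst; apply: (ltn_ord v).
have [vs' [es' [ev ee]]] := walk_range lX w un ues (ltn_ord u) l4.
by exists vs', es'; split=> //; apply/swalk_lft; rewrite -ev -ee.
Qed.

Lemma swalk_refl X u vs es : swalk X u u vs es -> vs = [::] /\ es = [::].
Proof.
case: vs => [|v vs]; case: es => [|e es] [] //= _ [lst [/andP[]]].
by rewrite -lst mem_last.
Qed.

Lemma swalk_from_leaf X f v vs es : leafy X -> 4 <= f -> f != v -> swalk X f v vs es ->
  exists vs' es', [/\ vs = lft o4 :: vs', es = stem f :: es' & swalk X (lft o4) v vs' es'].
Proof.
move=> lX fF fv; case: vs es => [|x vs] [|e es] [] //=.
  by move=> _ [/eqP]; rewrite (negPf fv).
move=> [eX [fe [xe w]]] [lst [/andP[fx un] /andP[ees ues]]].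
have ee := lX e f eX fe fF; move: xe; rewrite ee !inE => /orP[/eqP ex|/eqP ex]; last first.
  by move: fx; rewrite ex mem_head.
by exists vs, es; rewrite -ex; split.
Qed.

Lemma swalk_to_leaf X f u vs es : leafy X -> 4 <= f -> f != u -> swalk X u f vs es ->
  exists vs' es', [/\ vs = rcons vs' f, es = rcons es' (stem f) & swalk X u (lft o4) vs' es'].
Proof.
move=> lX fF fu [w [lst [un ues]]].
case/lastP: vs => [|vs x] in w lst un *; first by rewrite -lst eqxx in fu.
case/lastP: es => [|es e] in w ues *; first by case: vs w {lst un}.
rewrite last_rcons in lst; rewrite lst in w un *.
move/walk_rcons: w => [w [eX [le fe]]]; have ee := lX e f eX fe fF.
move: un ues; rewrite -rcons_cons !rcons_uniq => /andP[fn un] /andP[_ ues].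
exists vs, es; split=> //; first by rewrite ee.
split=> //; split=> //; move: le; rewrite ee !inE => /orP[/eqP //|/eqP el].
by move: fn; rewrite -el mem_last.
Qed.

(** Stems at either end are forced; removing them leaves a walk that comes from T. *)
Lemma swalk_tilde_unique T u v vs es vs' es' : is_hypertree T ->
  swalk (tilde n T) u v vs es -> swalk (tilde n T) u v vs' es' -> vs = vs' /\ es = es'.
Proof.
case=> _ hT; have lX := @tilde_leafy T.
have U1 a b ws fs ws' fs' : swalk (tilde n T) (lft a) (lft b) ws fs ->
    swalk (tilde n T) (lft a) (lft b) ws' fs' -> ws = ws' /\ fs = fs'.
  move=> /(swalk_range lX)[? [? [-> -> s1]]] /(swalk_range lX)[? [? [-> -> s2]]].
  by rewrite tildeK in s1 s2; have [-> ->] := (hT a b).2 _ _ _ _ s1 s2.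
have U2 x b ws fs ws' fs' : swalk (tilde n T) x (lft b) ws fs ->
    swalk (tilde n T) x (lft b) ws' fs' -> ws = ws' /\ fs = fs'.
  case: (lftP le4n x) => [[a ->]|xF]; first exact: U1.
  have xb : x != lft b by apply: contraTneq xF => ->; rewrite lft_lt.
  move=> /(swalk_from_leaf lX xF xb)[? [? [-> -> s1]]].
  by move=> /(swalk_from_leaf lX xF xb)[? [? [-> -> s2]]]; have [-> ->] := U1 _ _ _ _ _ _ s1 s2.
case: (lftP le4n v) => [[b ->]|vF]; first exact: U2.
have [->|vu] := eqVneq v u; first by move=> /swalk_refl[-> ->] /swalk_refl[-> ->].
move=> /(swalk_to_leaf lX vF vu)[? [? [-> -> s1]]].
by move=> /(swalk_to_leaf lX vF vu)[? [? [-> -> s2]]]; have [-> ->] := U2 _ _ _ _ _ _ s1 s2.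
Qed.

Lemma swalk_tilde_exists T u v : is_hypertree T -> exists vs es, swalk (tilde n T) u v vs es.
Proof.
case=> _ hT.
have out f vs : 4 <= f -> f \notin map lft vs.
  by move=> fF; apply/mapP => -[j _ e]; move: fF; rewrite e lft_lt.
have oute f es : 4 <= f -> stem f \notin map (fun E => lfts E) es.
  by move=> fF; apply/mapP => -[E _ e]; have := stem_neq E fF; rewrite e eqxx.
have E1 a b : exists vs es, swalk (tilde n T) (lft a) (lft b) (map lft vs) (map (fun E => lfts E) es).
  by have [[vs [es s]] _] := hT a b; exists vs, es; apply/swalk_lft; rewrite tildeK.
case: (lftP le4n u) => [[a ->]|uF]; case: (lftP le4n v) => [[b ->]|vF].
- by have [vs [es s]] := E1 a b; eexists; eexists; exact: s.
- have [vs [es [w [lst [un ues]]]]] := E1 a o4.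
  exists (rcons (map lft vs) v), (rcons (map (fun E => lfts E) es) (stem v)).
  split; first by apply/walk_rcons; rewrite lst tilde_stem // !inE !eqxx orbT.
  by rewrite last_rcons -rcons_cons !rcons_uniq un ues oute // -map_cons out.
- have [vs [es [w [lst [un ues]]]]] := E1 o4 b.
  exists (lft o4 :: map lft vs), (stem u :: map (fun E => lfts E) es).
  split; first by rewrite /= tilde_stem // !inE !eqxx orbT.
  by rewrite [last _ _]lst cons_uniq un /= ues oute // -map_cons out.
have [<-|uv] := eqVneq u v; first by exists [::], [::].
have nl f : 4 <= f -> f != lft o4 by move=> fF; apply: contraTneq fF => ->; rewrite lft_lt.
exists [:: lft o4; v], [:: stem u; stem v]; split.
  by rewrite /= !tilde_stem // !inE !eqxx !orbT.
rewrite /= !inE (negPf uv) (negPf (nl u uF)) eq_sym (negPf (nl v vF)).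
by rewrite !andbT; split=> //; split=> //; apply: contra uv => /eqP/(stem_inj uF) ->.
Qed.

Lemma tilde_hypertree T : is_hypertree T -> is_hypertree (tilde n T).
Proof.
move=> hT; split; first by apply: tilde_card; case: hT.
by move=> u v; split; [apply: swalk_tilde_exists | move=> *; apply: swalk_tilde_unique; eauto].
Qed.

Lemma untilde_hypertree X : leafy X -> is_hypertree X -> is_hypertree (untilde X).
Proof.
move=> lX [cX hX]; split=> [E|u v].
  by rewrite inE => /cX; rewrite card_imset.
have [[vs [es s]] un] := hX (lft u) (lft v); split.
  by have [vs' [es' [_ _ s']]] := swalk_range lX s; exists vs', es'.
move=> vs1 es1 vs2 es2 /swalk_lft s1 /swalk_lft s2.
by have [/(inj_map lftI) -> /(inj_map lftsI) ->] := un _ _ _ _ s1 s2.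
Qed.

(** A hyperedge through f lies in {1, f} because {f} is a component away from 1, and equals it by
    size; the walk from f to 1 shows that such a hyperedge exists. *)
Lemma splits_leafy X : is_hypertree X -> (forall f, 4 <= f -> splits X (lft o4) [set f]) ->
  leafy X /\ tilde n (untilde X) = X.
Proof.
move=> [cX hX] sX; have nl f : 4 <= f -> f != lft o4.
  by move=> fF; apply: contraTneq fF => ->; rewrite lft_lt.
have lX : leafy X.
  move=> e f eX fe fF; apply/eqP; rewrite eqEcard cards2 (leq_trans _ (cX e eX)) ?andbT.
    apply/subsetP => y ye; rewrite !inE; case: eqVneq => //= yo.
    by have := sX f fF e f y eX fe ye (nl f fF) yo; rewrite !inE eqxx => <-.
  by case: (_ != _).
split=> //; apply: untildeK => [f fF|e eX].
  have [[vs [es [w [lst _]]]] _] := hX f (lft o4).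
  case: vs es w lst => [|x vs] [|e es] //=.
    by move=> _ ef; have := nl f fF; rewrite ef eqxx.
  by move=> [eX [fe _]] _; rewrite -(lX e f eX fe fF).
have [/existsP[f /andP[fe fF]]|/existsPn h] := boolP [exists f, (f \in e) && (4 <= f)].
  by right; exists f => //; apply: lX fe fF.
by left=> x xe; have := h x; rewrite xe /= -ltnNge.
Qed.

End Tilde.

(** * Fixed points *)

Section FixedPoints.
Variables (n : nat) (le4n : 4 <= n).
Notation lft := (lft le4n).
Notation o4 := (ord0 : 'I_4).
Notation o := (lft o4).
Notation sigma f := (pconj o [set f]).
Implicit Types (alpha psi beta g : endo n) (X : hyp n) (f x : 'I_n) (S : {set 'I_n}).

Lemma o_neq f : 4 <= f -> o != f.
Proof. by move=> fF; apply: contraTneq fF => <-; rewrite lft_lt. Qed.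

Lemma o_notin S : (forall f, f \in S -> 4 <= f) -> o \notin S.
Proof. by move=> FS; apply/negP => /FS; rewrite lft_lt. Qed.

Lemma o_sigma f : 4 <= f -> o \notin [set f].
Proof. by move=> fF; rewrite inE o_neq. Qed.

(** For x other than f, [alpha x] is fixed by [sigma f]. On [alpha f] the map [sigma f] acts as
    conjugation by a_1, so their composite, again a partial conjugation, fixes it. Both cases follow
    from [pconj_fixed]. *)
Lemma commute_letters alpha f : conj_type alpha -> alpha o = [:: o] -> 4 <= f ->
  ecomp (sigma f) alpha = ecomp alpha (sigma f) ->
  (forall x, x != f -> f \notin alpha x) /\ {in alpha f, forall k, k = o \/ k = f}.
Proof.
move=> ca ao fF e; have ofs := o_sigma fF; have cs := conj_type_pconj ofs.
have ex x := congr1 (fun h : endo n => h x) e; rewrite /ecomp in ex.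
split=> [x xf|k kin].
  have := ex x; rewrite {2}/pconj inE (negPf xf) apply_seq1 reduce_id ?conj_type_reduced //.
  move=> /(pconj_fixed ofs (conj_type_reduced x ca)) h.
  by apply/negP => /h; rewrite set11.
have oo : o \notin ~: [set o] by rewrite !inE eqxx.
have ci := @conj_type_inner n [:: o].
(* The set here consists of all vertices except [o] and [f]. *)
have : apply (pconj o (symdiff (~: [set o]) [set f])) (alpha f) = alpha f.
  rewrite -pconjM // apply_ecomp; last exact: conj_type_pconj.
  rewrite ex pconj_in ?set11 // -[conjw _ _]/(inner [:: o] f) -[apply alpha _]/(ecomp alpha _ f).
  rewrite ecomp_inner // apply_seq1 ao -inner_pconj /= /ecomp -apply_ecomp //.
  by rewrite (innerVK [:: o]) apply_id reduce_id // conj_type_reduced.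
have osd : o \notin symdiff (~: [set o]) [set f] by rewrite !inE eqxx /= o_neq.
move/(pconj_fixed osd (conj_type_reduced f ca))/(_ k kin); rewrite !inE.
by case: (eqVneq k o) => [->|_]; [left | rewrite addTb negbK => /eqP; right].
Qed.

Lemma commute_ext alpha psi : conj_type alpha -> conj_type psi ->
  ecomp alpha psi = @idE n -> ecomp psi alpha = @idE n -> alpha o = [:: o] ->
  (forall f, 4 <= f -> ecomp (sigma f) alpha = ecomp alpha (sigma f)) ->
  is_aut0 (endo_retr le4n alpha) /\ ext_rel (endo_retr le4n alpha) alpha.
Proof.
move=> ca cp e1 e2 ao comm.
have po : psi o = [:: o].
  have : ecomp psi alpha o = [:: o] by rewrite e2.
  by rewrite /ecomp ao apply_seq1 reduce_id // conj_type_reduced.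
have comm' f : 4 <= f -> ecomp (sigma f) psi = ecomp psi (sigma f).
  move=> fF; have cs := conj_type_pconj (o_sigma fF).
  have csp : conj_type (ecomp (sigma f) psi) by apply: conj_type_ecomp.
  rewrite -[LHS]ecomp1i // -e2 -ecompA // [ecomp alpha _]ecompA // -comm //.
  by rewrite -[ecomp (ecomp _ alpha) _]ecompA // e1 ecompi1.
have ret j : map lft (endo_retr le4n alpha j) = alpha (lft j).
  rewrite -reduce_lft lft_retr ?reduce_id ?conj_type_reduced // => k kj.
  rewrite ltnNge; apply/negP => kF; have [h _] := commute_letters ca ao kF (comm k kF).
  have jk : lft j != k by apply: contraTneq kF => <-; rewrite lft_lt.
  by have := h (lft j) jk; rewrite kj.
split.
  split; first exact: endo_retr_conj_type.
  exists (endo_retr le4n psi); split; first exact: endo_retr_conj_type.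
  by rewrite -!endo_retrM // e1 e2 endo_retr_id.
apply/(ext_relP le4n); split=> [j|f fF]; first by rewrite ret.
have eo : endo_retr le4n alpha o4 = [:: o4] by rewrite /endo_retr ao retr_cons_lft.
have [_ af] := commute_letters ca ao fF (comm f fF).
(* The inverse commutes as well, so [psi f] is a preimage of [f] in the dihedral group, as
   [dihedral_aut] requires. *)
have [_ pf] := commute_letters cp po fF (comm' f fF).
have ef : apply alpha (psi f) = [:: f] by rewrite -/(ecomp alpha psi f) e1.
have [->|->] := dihedral_aut ca ao (o_neq fF) af pf (conj_type_reduced f cp) ef.
  by exists [::].
exists [:: o4]; split; first by rewrite eo [conjw _ _]reduce_ii.
by rewrite -(pconj_in (o_sigma fF) (set11 f)) /pconj set11.
Qed.

Lemma prodpc_based_base X b l : {in l, forall p, @based n X b p} -> prodpc l b = [:: b].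
Proof.
elim: l => //= p l IH bl; have [pp bp _] := bl p (mem_head _ _).
rewrite /ecomp IH => [|q ql]; last by apply: bl; rewrite inE ql orbT.
by rewrite apply_seq1 /pconj (negPf bp).
Qed.

(* Comparing [parity] on both sides determines the sets [supp k l] of the
   product [l] of carried partial conjugations equal to [alpha^-1 sigma alpha];
   hence that product is [sigma] itself. *)
Lemma fixed_commute X alpha f : conn X -> conj_type alpha -> alpha o = [:: o] ->
  4 <= f -> moves X (ecomp (sigma f) alpha) alpha ->
  splits X o [set f] /\ ecomp (sigma f) alpha = ecomp alpha (sigma f).
Proof.
move=> cX ca ao fF [w [l [cl e]]].
have ofs := o_sigma fF; have cs := conj_type_pconj ofs; have ci := @conj_type_inner n.
have csa := conj_type_ecomp cs ca.
have sao : ecomp (sigma f) alpha o = [:: o].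
  by rewrite /ecomp ao apply_seq1 /pconj inE (negPf (o_neq fF)).
have [|w1 [l1 [bl1 el1]]] := @prodpc_based n X o l.
  by move=> p /cl[/andP[pp _] c]; split=> //; apply/carriesP.
have cl1 := conj_type_prodpc (based_wf bl1).
have [w2 e2] : exists w2, ecomp (ecomp (sigma f) alpha) (prodpc l1) = ecomp (inner w2) alpha.
  move: e; rewrite el1 ecompA // ecomp_inner // -ecompA //.
  move/(inner_cancel (conj_type_ecomp csa cl1) (conj_type_ecomp (ci w) ca)).
  by rewrite ecompA // innerM => e; eexists; exact: e.
(* Both sides are compared at [o], which the left one fixes, so [w2] centralises a_1. If it is a_1
   itself, conjugation by a_1 is absorbed as one more based factor. *)
have [l2 [bl2 {}e2]] : exists l2, {in l2, forall p, based X o p} /\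
    ecomp (ecomp (sigma f) alpha) (prodpc l2) = alpha.
  have := congr1 (fun h : endo n => h o) e2; rewrite {1}/ecomp (prodpc_based_base bl1).
  rewrite apply_seq1 sao [RHS]/ecomp ao apply_seq1 [RHS]reduce_id ?conjw_reduced //.
  move/esym/conjw_eq1; rewrite -inner_reduce in e2; case=> ew; rewrite ew in e2.
    by exists l1; rewrite e2 inner_nil ecomp1i.
  have oo : o \notin ~: [set o] by rewrite !inE eqxx.
  have ei : ecomp (inner [:: o]) alpha = ecomp alpha (inner [:: o]).
    by rewrite ecomp_inner // apply_seq1 ao.
  have co := conj_type_pconj oo.
  exists (l1 ++ [:: (o, ~: [set o])]); split=> [p|].
    rewrite mem_cat inE => /orP[/bl1 //|/eqP ->]; split=> //= d x y _ _ _ xo yo.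
    by rewrite !inE xo yo.
  rewrite prodpc_cat ?(based_wf bl1) //= ?oo // ecompi1 // ecompA // e2 ei.
  by rewrite inner_pconj -ecompA // pconjK // ecompi1.
have cl2 := conj_type_prodpc (based_wf bl2).
have su k : supp k l2 = if k == o then [set f] else set0.
  apply/setP => j; have [ks _ _] := based_supp k bl2.
  (* The diagonal is separate because parity is undetermined there; a based factor never has k in
     its own set. *)
  have [<-|kj] := eqVneq k j.
    rewrite (negPf ks); case: eqP => [->|_]; rewrite inE //.
    by rewrite (negPf (o_neq fF)).
  have [c pc] : exists c, parity alpha k j c by have [u eu] := ca j; eexists; exists u.
  have := parity_ecomp csa (parity_ecomp cs (parity_pconj k j ofs) pc) (parity_prodpc k j (based_wf bl2)).
  have cancel (x y z : bool) : (x (+) y) (+) z = y -> z = x by case: x; case: y; case: z.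
  rewrite e2 => /(parity_inj kj)/(_ pc)/cancel ->.
  by rewrite eq_sym; case: eqP; rewrite ?in_set0.
have [os _ sX] := based_supp o bl2; rewrite /= su eqxx in sX; split=> //.
have bsig : based X o (o, [set f]) by [].
have : prodpc ((o, [set f]) :: l2) = @idE n.
  apply: (prodpc_supp0 (b := o) cX) => [p|k]; first by rewrite inE => /orP[/eqP->|/bl2].
  apply/setP => j; have := congr1 (fun A : {set 'I_n} => j \in A) (su k).
  rewrite !inE /= oddD => ->; rewrite oddb eq_sym.
  by case: eqP => _; rewrite !inE ?addbb.
move=> /= e3; have e4 : prodpc l2 = sigma f.
  by rewrite -[LHS]ecomp1i // -(pconjK ofs) -ecompA // e3 ecompi1.
rewrite e4 in e2.
by rewrite -{2}e2 -ecompA // pconjK // ecompi1.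
Qed.

Lemma fixed_in_span (v : vtx n) : valid_vtx v ->
  (forall f, 4 <= f -> vrel (act (sigma f) v) v) -> in_tilde_span v.
Proof.
case: v => alpha X [[/= ca [psi [cp [/eqE_eq e1 /eqE_eq e2]]]] hX] fix_.
have ci := @conj_type_inner n; have [u eu] := ca o.
(* Normalise the representative, without changing its outer class, so that it fixes a_1. *)
pose a0 := ecomp (inner (rev u)) alpha; pose p0 := ecomp psi (inner u).
have ca0 : conj_type a0 by apply: conj_type_ecomp.
have cp0 : conj_type p0 by apply: conj_type_ecomp.
have m0 : moves X alpha a0 by apply: moves_inner.
have a0o : a0 o = [:: o].
  have := congr1 (fun h : endo n => h o) (innerVK u).
  by rewrite /ecomp /inner /a0 /ecomp eu.
have ap0 : ecomp a0 p0 = @idE n.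
  by rewrite /a0 /p0 -ecompA // [ecomp alpha _]ecompA // e1 ecomp1i // innerVK.
have pa0 : ecomp p0 a0 = @idE n.
  by rewrite /a0 /p0 -ecompA // [ecomp (inner u) _]ecompA // innerKV ecomp1i.
have [sX comm] : (forall f, 4 <= f -> splits X o [set f]) /\
    (forall f, 4 <= f -> ecomp (sigma f) a0 = ecomp a0 (sigma f)).
  suff h f (fF : 4 <= f) : splits X o [set f] /\ ecomp (sigma f) a0 = ecomp a0 (sigma f).
    by split=> f fF; case: (h f fF).
  apply: fixed_commute => //; first exact: hypertree_conn.
  have cs := conj_type_pconj (o_sigma fF).
  have csa := conj_type_ecomp cs ca.
  apply: (moves_trans (conj_type_ecomp cs ca0) csa ca0).
    by apply: moves_act => //; apply: moves_sym.
  apply: (moves_trans csa ca ca0) m0.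
  by have /vrelE[] := fix_ f fF.
have [autphi ext] := commute_ext ca0 cp0 ap0 pa0 a0o comm.
have [lX eX] := splits_leafy hX sX.
exists (endo_retr le4n a0), (untilde le4n X), a0; split=> //.
  exact: untilde_hypertree.
by apply/vrelE; rewrite eX.
Qed.

Lemma ext_id_F S : (forall f, f \in S -> 4 <= f) -> ext_rel (@idE 4) (pconj o S).
Proof.
move=> FS; have oS := o_notin FS; apply/(ext_relP le4n); split=> [j|f fF].
  by rewrite /pconj; case: ifP => // /FS; rewrite lft_lt.
have [fS|fS] := boolP (f \in S); last by exists [::]; rewrite /pconj (negPf fS).
by exists [:: o4]; rewrite pconj_in // /idE [conjw _ o4]reduce_ii.
Qed.

Lemma prodpc_F l :
  (forall p, p \in l -> val p.1 = 0 /\ exists f : 'I_n, 4 <= f /\ p.2 = [set f]) ->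
  exists S, (forall f, f \in S -> 4 <= f) /\ prodpc l = pconj o S.
Proof.
elim: l => [_|[i D] l IH h]; first by exists set0; rewrite pconj0; split=> // f; rewrite inE.
have [|S [FS eS]] := IH; first by move=> p pl; apply: h; rewrite inE pl orbT.
have /= [i0 [f [fF ->]]] := h _ (mem_head _ _).
have -> : i = o by apply: val_inj.
exists (symdiff [set f] S); rewrite eS pconjM ?o_sigma ?o_notin //; split=> // x.
by rewrite !inE; case: eqP => [->|_] //= /FS.
Qed.

(** Up to an inner automorphism [g] is some x_{1,S}, an extension of the identity. So it turns
    [beta] into another extension of the same [phi], which is the same vertex. *)
Lemma span_fixed (v : vtx n) g : valid_vtx v -> in_tilde_span v -> inG g -> vrel (act g v) v.
Proof.
case: v => alpha X [[/= ca _] hX] [phi [T [beta [[cphi _] hT eb]]]] /vrelE /= [eX m].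
case=> l [hl [w /eqE_eq ew]]; have [S [FS eS]] := prodpc_F hl; rewrite eS in ew.
have ci := @conj_type_inner n; have cS := conj_type_pconj (o_notin FS).
have cb := ext_conj_type le4n cphi eb.
have -> : act g (alpha, X) = (ecomp (inner (rev w)) (ecomp (pconj o S) alpha), X).
  congr pair; apply: eqE_eq => x; rewrite ecompA // ew /ecomp /=.
  rewrite -[RHS]/(apply (ecomp (inner (rev w)) (ecomp (inner w) g)) (alpha x)).
  rewrite apply_ecomp // apply_ecomp // -apply_ecomp // innerVK apply_id.
  by rewrite reduce_id // apply_reduced.
have cSa := conj_type_ecomp cS ca; have cSb := conj_type_ecomp cS cb.
apply/vrelE; split=> //=.
apply: (moves_trans (conj_type_ecomp (ci _) cSa) cSa ca).
  by apply: moves_sym (moves_inner _ _ _) => //; apply: conj_type_ecomp.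
apply: (moves_trans cSa cSb ca); first exact: moves_act.
apply: (moves_trans cSb cb ca); last exact: moves_sym.
rewrite eX; apply: (moves_ext_same le4n T cphi) => //.
by rewrite -(ecomp1i cphi); apply: (ext_ecomp le4n) (ext_id_F FS) eb => //; apply: conj_type_id.
Qed.

Lemma sigma_inG f : 4 <= f -> inG (sigma f).
Proof.
move=> fF; have cs := conj_type_pconj (o_sigma fF).
exists [:: (o, [set f])]; split=> [p|]; first by rewrite inE => /eqP ->; split=> //; exists f.
exists [::] => i; rewrite inner_nil ecomp1i // prodpc1 //; exact: o_sigma.
Qed.

End FixedPoints.

Theorem theorem6p15 (n : nat) (hn : 5 <= n) :
  (* 1. fixed point set of G = full subcomplex spanned by the [alpha, Theta~]:
        for every simplex s of K_n, TFAE
        (i) every g in G maps s onto itself (necessary for a fixed interior point),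
        (ii) all vertices of s are of the form [alpha, Theta~],
        (iii) every g in G fixes every vertex of s (so s is fixed pointwise). *)
  (forall s : seq (vtx n), is_chain s ->
     ((forall g, inG g ->
         (forall v, inL v s -> exists w, inL w s /\ vrel (act g v) w) /\
         (forall w, inL w s -> exists v, inL v s /\ vrel (act g v) w))
      <-> (forall v, inL v s -> in_tilde_span v)) /\
     ((forall v, inL v s -> in_tilde_span v)
      <-> (forall g, inG g -> forall v, inL v s -> vrel (act g v) v))) /\
  (* 2. the embedding of Out^0(W_4) exists and lands in Out^0(W_n) *)
  (forall phi : endo 4, is_aut0 phi -> exists beta : endo n, ext_rel phi beta) /\
  (forall (phi : endo 4) (beta : endo n), is_aut0 phi -> ext_rel phi beta -> is_aut0 beta) /\
  (* 3. [alpha,Theta] |-> [alpha,Theta~] is well defined and injective on vertices *)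
  (forall (phi psi : endo 4) (T L : hyp 4) (beta gamma : endo n),
     is_aut0 phi -> is_aut0 psi -> is_hypertree T -> is_hypertree L ->
     ext_rel phi beta -> ext_rel psi gamma ->
     (vrel (phi, T) (psi, L) <-> vrel (beta, tilde n T) (gamma, tilde n L))) /\
  (* 4. it preserves and reflects the order (hence a simplicial isomorphism of
        K_4 onto the subcomplex spanned by its image) *)
  (forall (phi psi : endo 4) (T L : hyp 4) (beta gamma : endo n),
     is_aut0 phi -> is_aut0 psi -> is_hypertree T -> is_hypertree L ->
     ext_rel phi beta -> ext_rel psi gamma ->
     (vle (phi, T) (psi, L) <-> vle (beta, tilde n T) (gamma, tilde n L))) /\
  (* 5. its image consists of valid vertices of K_n *)
  (forall (phi : endo 4) (T : hyp 4) (beta : endo n),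
     is_aut0 phi -> is_hypertree T -> ext_rel phi beta ->
     valid_vtx (beta, tilde n T)) /\
  (* 6. equivariance for Out^0(W_4) *)
  (forall (chi phi : endo 4) (T : hyp 4) (cb beta gamma : endo n),
     is_aut0 chi -> is_aut0 phi -> is_hypertree T ->
     ext_rel chi cb -> ext_rel phi beta -> ext_rel (ecomp chi phi) gamma ->
     vrel (gamma, tilde n T) (act cb (beta, tilde n T))).
Proof.
have le4n : 4 <= n by apply: ltnW.
have is_conj m (phi : endo m) : is_aut0 phi -> conj_type phi by case.
have tilde_eq T L : tilde n T = tilde n L -> T = L.
  by move=> e; rewrite -(tildeK le4n T) e tildeK.
split=> [s [vs cs]|].
  have ii_iii : (forall v, inL v s -> in_tilde_span v) ->
      forall g, inG g -> forall v, inL v s -> vrel (act g v) v.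
    by move=> sp g gG v vin; apply: (span_fixed le4n) => //; [apply: vs | apply: sp].
  split; split=> //.
  - move=> st v vin; have vv := vs v vin; have cv := is_conj _ _ vv.1.
    apply: (fixed_in_span (le4n:=le4n) vv) => f fF.
    (* A simplex preserved setwise is fixed vertexwise: the image of [v] is a vertex of the chain
       with the same hypertree, and comparable vertices with equal hypertrees coincide. *)
    have [/(_ v vin)[w [win /vrelE /= [evw m]]] _] := st _ (sigma_inG le4n fF).
    have cw := is_conj _ _ (vs w win).1.
    have csv : conj_type (ecomp (pconj (lft le4n ord0) [set f]) v.1).
      by apply: conj_type_ecomp => //; apply: conj_type_pconj; apply: o_sigma.
    apply/vrelE; split=> //=; apply: moves_trans m _ => //.
    have [/vleE[_ h]|/vleE[_ h]] := cs v w vin win; last exact: h.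
    by apply: moves_sym => //; rewrite evw.
  - move=> sp g gG; have fx := ii_iii sp g gG.
    by split=> v vin; exists v; split=> //; apply: fx.
  - move=> fx v vin; apply: (fixed_in_span (le4n:=le4n) (vs v vin)) => f fF.
    by apply: fx vin; apply: sigma_inG.
split; first by move=> phi /is_conj; apply: (ext_exists le4n).
split; first by move=> phi beta; apply: (ext_aut le4n).
split.
  move=> phi psi T L beta gamma /is_conj cp /is_conj cs _ _ eb eg.
  rewrite !vrelE /=; split=> -[].
    by move=> -> m; split=> //; apply: (moves_tilde le4n) cp cs eb eg m.
  by move=> /tilde_eq -> m; split=> //; apply: (moves_tilde_inv le4n cp cs eb eg m).
split.
  move=> phi psi T L beta gamma /is_conj cp /is_conj cs hT hL eb eg.
  rewrite !vleE /=; split=> -[].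
    by move=> f m; split; [apply: folds_tilde | apply: (moves_tilde le4n) cp cs eb eg m].
  move=> f m; split; last exact: (moves_tilde_inv le4n cp cs eb eg m).
  by apply: folds_tilde_inv f => //; case: hL.
split.
  by move=> phi T beta ap hT eb; split; [apply: (ext_aut le4n) eb | apply: tilde_hypertree].
(* [gamma] and [ecomp cb beta] are two extensions of [ecomp chi phi]. *)
move=> chi phi T cb beta gamma /is_conj cc /is_conj cp _ ec eb eg.
apply/vrelE; split=> //=; apply: (moves_ext_same le4n T (conj_type_ecomp cc cp) eg).
exact: (ext_ecomp le4n cc cp ec eb).
Qed.
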